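(* Let $U$ be an optimal prefix-free machine and let $f:2^\omega\to[0,1]$, $f(x)=\sum_{\sigma\le_L x}2^{-K_U(\sigma)}$. Then for every real $x\in 2^\omega$: (i) $x'\ge_T\emptyset'\oplus x\ge_T f(x)$; (ii) $f(x)'\ge_T\emptyset'\oplus f(x)\ge_T x$; (iii) $f(x)\oplus x\ge_T\emptyset'$.
   Context: A machine is a partial computable function $M$ from $2^{<\omega}$ to $2^{<\omega}$; it is prefix-free if its domain is a prefix-free set. $K_M(\sigma)=\min\{|\tau|: M(\tau)=\sigma\}$ ($=\infty$ if there is no such $\tau$, with $2^{-\infty}=0$). A prefix-free machine $U$ is optimal if for each prefix-free machine $M$ there is a constant $c$ with $K_U(\sigma)\le K_M(\sigma)+c$ for all $\sigma$. For $\sigma\in 2^{<\omega}$ and $x\in 2^\omega$, $\sigma<_L x$ means that there is $n$ with $\sigma\upharpoonright n=x\upharpoonright n$, $\sigma(n)=0$ and $x(n)=1$; $\sigma\le_L x$ means that $\sigma<_L x$ or $\sigma$ is an initial segment of $x$. $z'$ denotes the Turing jump of $z$, $\oplus$ the usual join ($(x\oplus y)(2i)=x(i)$, $(x\oplus y)(2i+1)=y(i)$). Reals in $[0,1]$ are identified with their binary expansions for computability-theoretic purposes. *)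

(* Defs.v *)
From HB Require Import structures.
From mathcomp Require Import all_boot all_order all_algebra.
From mathcomp Require Import boolp classical_sets functions cardinality fsbigop.
From mathcomp Require Import reals ereal topology normedtype sequences esum.
From mathcomp Require Import finmap lra zify.

Set Implicit Arguments.
Unset Strict Implicit.
Unset Printing Implicit Defensive.

Import Order.TTheory GRing.Theory Num.Theory.
Import numFieldNormedType.Exports.

Local Open Scope classical_set_scope.
Local Open Scope nat_scope.

(** Elements of [2^omega], also read as subsets of [nat]. *)
Definition cantor := nat -> bool.

Definition str := seq bool.

(** Cantor's pairing function; bijective by [cunpairK] and [cpair_inj]. *)
Definition cpair (a b : nat) : nat := 'C((a + b).+1, 2) + b.

(** Programs for the functions [nat -> nat] that are partial recursive in an
    oracle.  All functions are unary, several arguments being packed with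
    [cpair]. *)
Inductive code : Type :=
| Zero | Succ | Fst | Snd | Oracle
| Pair of code & code
| Comp of code & code
| Prec of code & code
| Mu of code.

(** [eval x c n v]: program [c] with oracle [x] halts on input [n] with
    output [v]. *)
Inductive eval (x : cantor) : code -> nat -> nat -> Prop :=
| eval_Zero n : eval x Zero n 0
| eval_Succ n : eval x Succ n n.+1
| eval_Fst a b : eval x Fst (cpair a b) a
| eval_Snd a b : eval x Snd (cpair a b) b
| eval_Oracle n : eval x Oracle n (x n)
| eval_Pair c d n u v :
    eval x c n u -> eval x d n v -> eval x (Pair c d) n (cpair u v)
| eval_Comp c d n u v :
    eval x d n u -> eval x c u v -> eval x (Comp c d) n v
| eval_Prec0 c d a v :
    eval x c a v -> eval x (Prec c d) (cpair a 0) v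
| eval_PrecS c d a n u v :
    eval x (Prec c d) (cpair a n) u -> eval x d (cpair a (cpair n u)) v ->
    eval x (Prec c d) (cpair a n.+1) v
| eval_Mu c a m (u : nat -> nat) :
    (forall i, i < m -> eval x c (cpair a i) (u i).+1) ->
    eval x c (cpair a m) 0 ->
    eval x (Mu c) a m.

Fixpoint encode (c : code) : nat :=
  match c with
  | Zero => cpair 0 0
  | Succ => cpair 1 0
  | Fst => cpair 2 0
  | Snd => cpair 3 0
  | Oracle => cpair 4 0
  | Pair c d => cpair 5 (cpair (encode c) (encode d))
  | Comp c d => cpair 6 (cpair (encode c) (encode d))
  | Prec c d => cpair 7 (cpair (encode c) (encode d))
  | Mu c => cpair 8 (encode c)
  end.

Definition turing_le (y x : cantor) : Prop :=
  exists c, forall n, eval x c n (y n).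

Notation "x >=T y" := (turing_le y x) (at level 70, no associativity).

Definition jump (x : cantor) : cantor := fun e =>
  `[< exists c v, encode c = e /\ eval x c e v >].

Definition join (x y : cantor) : cantor := fun i =>
  if odd i then y i./2 else x i./2.

Definition emptyset : cantor := fun=> false.

(** Identification of [2^{<omega}] with [nat] (bijective base 2, least
    significant digit first). *)
Definition str_code (s : str) : nat :=
  foldr (fun (b : bool) n => n.*2 + b.+1) 0 s.

Definition machine := str -> option str.

Definition partial_computable (M : machine) : Prop :=
  exists c, forall s v,
    eval emptyset c (str_code s) v <-> omap str_code (M s) = Some v.

Definition prefix_free (M : machine) : Prop :=
  forall s t, M s <> None -> M t <> None -> prefix s t -> s = t.

Definition prefix_free_machine (M : machine) : Prop :=
  partial_computable M /\ prefix_free M.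

(** [None] stands for infinity. *)
Definition K (M : machine) (s : str) : option nat :=
  if pselect (exists n, `[< exists t, M t = Some s /\ size t = n >]) is left ex
  then Some (ex_minn ex) else None.

(** The order of [nat] extended with a top element [None]. *)
Definition le_inf (a b : option nat) : bool :=
  match a, b with
  | _, None => true
  | None, Some _ => false
  | Some m, Some n => m <= n
  end.

Definition optimal (U : machine) : Prop :=
  prefix_free_machine U /\
  forall M, prefix_free_machine M ->
    exists c, forall s, le_inf (K U s) (omap (addn c) (K M s)).

Definition ltL (s : str) (x : cantor) : Prop :=
  exists n, [/\ n < size s, take n s = mkseq x n,
                nth false s n = false & x n = true].

Definition initial_segment (s : str) (x : cantor) : Prop :=
  s = mkseq x (size s).

Definition leL (s : str) (x : cantor) : Prop :=
  ltL s x \/ initial_segment s x.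

Local Open Scope ring_scope.
Local Open Scope ereal_scope.

(** [2^{-a}], with [2^{-oo} = 0]. *)
Definition exp2N (R : realType) (a : option nat) : R :=
  if a is Some n then (2 ^- n)%R else 0%R.

(** The values are in [0, 1] by [f_ge0] and [f_le1] below. *)
Definition f (R : realType) (U : machine) (x : cantor) : \bar R :=
  \esum_(s in [set s | leL s x]) (exp2N R (K U s))%:E.

(** The real with binary expansion [0.z(0)z(1)...]; dyadic rationals have two
    expansions. *)
Definition binary_expansion (R : realType) (z : cantor) (r : \bar R) : Prop :=
  r = \sum_(0 <= i <oo) ((z i)%:R / 2 ^+ i.+1)%:E.

Section cpair_bij.
Local Open Scope nat_scope.

Definition cnext (p : nat * nat) : nat * nat :=
  if p.1 is a.+1 then (a, p.2.+1) else (p.2.+1, 0).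

Definition cunpair (n : nat) : nat * nat := iter n cnext (0, 0).

Lemma cunpairK n : cpair (cunpair n).1 (cunpair n).2 = n.
Proof.
elim: n => [//|n]; rewrite /cunpair iterS.
case: (iter n cnext (0, 0)) => [[|a] b] /= <-; rewrite /cpair.
  by rewrite !addn0 add0n binS bin1 addnS.
by rewrite addSnnS addnS.
Qed.

Lemma cpair_inj a b a' b' : cpair a b = cpair a' b' -> a = a' /\ b = b'.
Proof.
have H (m n k l : nat) : m + n < k + l -> cpair m n < cpair k l.
  move=> lt; rewrite /cpair.
  have : 'C((m + n).+2, 2) <= 'C((k + l).+1, 2) by apply: leq_bin2l; lia.
  by rewrite binS bin1; lia.
move=> e.
have [lt|gt|eab] := ltngtP (a + b) (a' + b').
- by have := H _ _ _ _ lt; rewrite e ltnn.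
- by have := H _ _ _ _ gt; rewrite e ltnn.
- by move: e; rewrite /cpair eab; lia.
Qed.

End cpair_bij.

Section f_range.
Variable R : realType.

Lemma kraft (N : nat) (s : seq str) : uniq s ->
  (forall t, t \in s -> (size t <= N)%N) ->
  (forall t u, t \in s -> u \in s -> prefix t u -> t = u) ->
  (\sum_(t <- s) 2 ^- size t <= 1 :> R)%R.
Proof.
elim: N s => [|N IH] s us sz pf.
  have : {subset s <= [:: [::]]}.
    by move=> t /sz; rewrite leqn0 size_eq0 => /eqP ->; rewrite inE.
  move=> /(uniq_leq_size us); case: s us sz pf => [|t [|? ?]] // _ sz _ _.
    by rewrite big_nil.
  rewrite big_seq1; have := sz t (mem_head _ _).
  by rewrite leqn0 => /eqP ->; rewrite expr0 invr1.
have [nils|nils] := boolP ([::] \in s).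
  have : {subset s <= [:: [::]]}.
    by move=> t ts; rewrite inE -(pf _ _ nils ts (prefix0s _)).
  move=> /(uniq_leq_size us); case: s nils {us sz pf} => [|t [|? ?]] //.
  by rewrite inE => /eqP <- _; rewrite big_seq1 expr0 invr1.
pose sub b := [seq behead t | t <- s & head false t == b].
have subE b v : v \in sub b -> (b :: v) \in s.
  move=> /mapP[[|c t]]; rewrite mem_filter /= => /andP[/eqP].
    by move=> _; rewrite (negbTE nils).
  by move=> -> ts ->.
have half b : (\sum_(t <- s | head false t == b) 2 ^- size t =
               2^-1 * \sum_(t <- sub b) 2 ^- size t :> R)%R.
  rewrite big_map big_filter mulr_sumr [LHS]big_seq_cond [RHS]big_seq_cond.
  apply: eq_bigr => -[|c t] /andP[ts _] /=.
    by rewrite ts in nils.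
  by rewrite exprS invfM.
have le1 b : (\sum_(t <- sub b) 2 ^- size t <= 1 :> R)%R.
  apply: IH.
  - rewrite map_inj_in_uniq ?filter_uniq// => t u.
    rewrite !mem_filter => /andP[ht ts] /andP[hu us'].
    case: t u ht ts hu us' => [|c t] [|d u] /=; rewrite ?(negbTE nils)//.
    by move=> /eqP -> _ /eqP -> _ ->.
  - by move=> t /subE /sz.
  - move=> t u /subE ts /subE us' tu.
    suff [->] : b :: t = b :: u by [].
    by apply: pf => //=; rewrite eqxx.
rewrite (bigID (fun t => head false t == true)) /=.
rewrite [X in (_ + X)%R](eq_bigl (fun t => head false t == false)); last first.
  by move=> t; case: (head false t).
rewrite !half; have := le1 true; have := le1 false; lra.
Qed.

Lemma exp2N_ge0 a : (0 <= exp2N R a)%R.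
Proof. by case: a => //= n; rewrite invr_ge0 exprn_ge0. Qed.

Lemma K_program M s n : K M s = Some n -> exists t, M t = Some s /\ size t = n.
Proof.
by rewrite /K; case: pselect => // ex [<-]; case: ex_minnP => m /asboolP.
Qed.

Lemma f_ge0 U x : 0 <= f R U x.
Proof. by apply: esum_ge0 => s _; rewrite lee_fin exp2N_ge0. Qed.

Lemma f_le1 U x : prefix_free U -> f R U x <= 1.
Proof.
move=> pfU; apply: ub_ereal_sup => _ [A [finA _] <-].
rewrite fsbig_finite//= sumEFin lee_fin.
pose g s : str := if pselect (exists t, U t = Some s /\ K U s = Some (size t))
  is left ex then projT1 (cid ex) else [::].
have gP s : K U s != None -> U (g s) = Some s /\ K U s = Some (size (g s)).
  case E : (K U s) => [n|//] _; rewrite -E /g; case: pselect => [ex|].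
    by case: cid.
  by case: (K_program E) => t [Ut st] []; exists t; rewrite E st.
rewrite (bigID (fun s => K U s != None)) /= [X in (_ + X)%R]big1 ?addr0; last first.
  by move=> s /negPn /eqP ->.
rewrite (eq_bigr (fun s => 2 ^- size (g s))%R); last first.
  by move=> s /gP [_ ->].
rewrite -big_filter -(big_map g xpredT (fun t => 2 ^- size t)%R).
set S := map _ _.
have SP t : t \in S -> exists2 s, t = g s & U t = Some s.
  move=> /mapP[s]; rewrite mem_filter => /andP[/gP[Us _] _] ->.
  by exists s.
apply: (@kraft (\max_(t <- S) size t)).
- rewrite map_inj_in_uniq ?filter_uniq ?fset_uniq// => s t.
  rewrite !mem_filter => /andP[/gP[Us _] _] /andP[/gP[Ut _] _] e.
  by move: Us; rewrite e Ut => -[].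
- by move=> t tS; rewrite (big_rem _ tS) /= leq_maxl.
- move=> t u /SP[? _ Ut] /SP[? _ Uu] tu.
  by apply: pfU tu; rewrite ?Ut ?Uu.
Qed.

End f_range.

Lemma binary_expansion_ex (R : realType) (r : \bar R) :
  0 <= r <= 1 -> exists z, binary_expansion z r.
Proof.
case: r => [r| |] /andP[]; rewrite ?leNye ?leye_eq// !lee_fin => r0 r1.
pose a := fix a n : R := if n is m.+1
  then (2 * a m - (1 <= 2 * a m)%R%:R)%R else r.
pose z n := (1 <= 2 * a n)%R.
have a01 n : (0 <= a n <= 1)%R.
  elim: n => [|n IH] /=; first by rewrite r0.
  by case: (lerP 1 (2 * a n)%R) => /=; lra.
have S n : (\sum_(0 <= i < n) (z i)%:R / 2 ^+ i.+1 = r - a n / 2 ^+ n)%R.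
  elim: n => [|n IH]; first by rewrite big_nil expr0 divr1 subrr.
  rewrite big_nat_recr//= IH exprS invfM -/(z n); lra.
exists z; rewrite /binary_expansion; apply/esym/cvg_lim => //.
under eq_fun do rewrite sumEFin S.
apply: cvg_EFin; first by near=> n.
rewrite -[X in _ --> X]subr0; apply: cvgB; first exact: cvg_cst.
apply: (@squeeze_cvgr _ _ _ _ (fun=> 0%R) (fun n => geometric 1 2^-1 n)%R).
- near=> n; have /andP[an0 an1] := a01 n.
  rewrite /geometric/= mul1r exprVn mulr_ge0 ?invr_ge0 ?exprn_ge0//=.
  by rewrite ler_piMl// invr_ge0 exprn_ge0.
- exact: cvg_cst.
- by apply: cvg_geometric; rewrite ger0_norm; lra.
Unshelve. all: by end_near. Qed.

(* Main.v *)
Require Import Defs.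
From mathcomp Require Import all_boot all_order all_algebra reals.
From mathcomp Require Import boolp classical_sets functions ereal topology.
From mathcomp Require Import normedtype sequences esum.
From mathcomp Require Import zify ring lra.
Import Defs.

Set Implicit Arguments.
Unset Strict Implicit.
Unset Printing Implicit Defensive.

(** Write [f_s(y)] for the part of the sum [f(y)] that is known at stage [s]:
    only strings with code below [s] count, and the complexity of a string is
    replaced by the length of the shortest program found so far.  This is a
    fraction with denominator [2^s] whose numerator [f_num] is computable from
    [y] and [s], and [f_s(y)], called [f_stage] below, increases to [f(y)].  Three remarks give the
    theorem.

    - The set of the strings [a <=L y] grows with [y], so what is missing from
      [f_s(y)] is at most what is missing at the greatest sequence, [1^omega].
      There the error no longer depends on [y], and the halting problem tells
      whether it can still exceed [2^-k]; this gives a modulus of convergence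
      that is valid for all [y] at once ([exists_modulus]).  Hence the halting
      problem and [x] together approximate [f(x)] to any precision, which
      determines the binary digits unless they are eventually constant; in that
      case they are computable anyway ([computable_value]).

    - If [a <=L x] then [f(a 0^omega) <= f(x)].  Otherwise the sum for
      [a 0^omega] contains that for [x] and also the term of [a] itself, so
      [f(x)] is smaller by at least [2^-K(a)].  A positive lower bound on this
      gap is found by searching for any program that outputs [a]; with the
      modulus above, approximations of [f(x)] and [f(a 0^omega)] then decide
      [a <=L x], and these answers determine the bits of [x] one after the
      other ([computable_input]).

    - All strings [0^t] are [<=L x].  If the [n]-th program halts and [t] is the
      first stage that shows it, then [0^t] has complexity at most [n + d], since
      it is computed from [n].  From [f(x)] and [x] one finds a stage [s] with
      [f(x) - f_s(x) < 2^-(n + d)]; such a stage already counts [0^t], so [t]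
      is at most [s], and running the program for [s] steps decides whether it
      halts ([computable_halting]).

    The recursion theory behind this is a universal machine with a step counter
    ([run]), closure properties of the total computable functions, and the fact
    that the jump decides existential questions about computable relations
    ([computable_exists_jump]); the latter also shows that the jump of [x]
    computes both [x] and the halting problem. *)

(** * Total computable functions *)

Definition p1 n := (cunpair n).1.
Definition p2 n := (cunpair n).2.

Arguments p1 : simpl never.
Arguments p2 : simpl never.
Arguments cpair : simpl never.

Lemma pK n : cpair (p1 n) (p2 n) = n. Proof. exact: cunpairK. Qed.
Lemma p1K a b : p1 (cpair a b) = a.
Proof. by have [] := cpair_inj (pK (cpair a b)). Qed.
Lemma p2K a b : p2 (cpair a b) = b.
Proof. by have [] := cpair_inj (pK (cpair a b)). Qed.

Lemma eval_inv x c n v : eval x c n v ->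
  match c with
  | Zero => v = 0
  | Succ => v = n.+1
  | Fst => v = p1 n
  | Snd => v = p2 n
  | Oracle => v = x n
  | Pair c d => exists u w, [/\ eval x c n u, eval x d n w & v = cpair u w]
  | Comp c d => exists2 u, eval x d n u & eval x c u v
  | Prec c d =>
      if p2 n is m.+1 then
        exists2 u, eval x (Prec c d) (cpair (p1 n) m) u &
                   eval x d (cpair (p1 n) (cpair m u)) v
      else eval x c (p1 n) v
  | Mu c => (forall i, i < v -> exists u, eval x c (cpair n i) u.+1) /\
            eval x c (cpair n v) 0
  end.
Proof.
case=> {c n v} //.
- by move=> a b; rewrite p1K.
- by move=> a b; rewrite p2K.
- by move=> c d n u v cu dv; exists u, v.
- by move=> c d n u v du cv; exists u.
- by move=> c d a v cv; rewrite p1K p2K.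
- by move=> c d a n u v cu dv; rewrite p1K p2K; exists u.
- by move=> c a m u cu c0; split=> // i im; exists (u i); apply: cu.
Qed.

Lemma eval_functional x c n u v : eval x c n u -> eval x c n v -> u = v.
Proof.
elim: c n u v => [||||| c IHc d IHd | c IHc d IHd | c IHc d IHd | c IHc] n u v.
1-5: by move=> /eval_inv -> /eval_inv ->.
- move=> /eval_inv [a [b [ca db ->]]] /eval_inv [a' [b' [ca' db' ->]]].
  by rewrite (IHc _ _ _ ca ca') (IHd _ _ _ db db').
- move=> /eval_inv [a da cu] /eval_inv [b db cv].
  by move: cu cv; rewrite (IHd _ _ _ da db); apply: IHc.
- rewrite -(pK n); elim: (p2 n) u v => [|m IHm] u v /eval_inv + /eval_inv.
    by rewrite p1K p2K; apply: IHc.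
  rewrite p1K p2K => -[a ea da] [b eb db].
  by move: da db; rewrite (IHm _ _ ea eb); apply: IHd.
- move=> /eval_inv [lu eu] /eval_inv [lv ev].
  have [/lv[w ew]|/lu[w ew]|//] := ltngtP u v.
  + by have := IHc _ _ _ eu ew.
  + by have := IHc _ _ _ ev ew.
Qed.

(** With total functions, algorithms can be written as ordinary functions on
    [nat] and turned into programs by the closure lemmas that follow. *)
Definition computable (x : cantor) (g : nat -> nat) :=
  exists c, forall n, eval x c n (g n).

Section Closure.
Variable x : cantor.
Local Notation comp := (computable x).

Lemma computable_ext g h : g =1 h -> comp g -> comp h.
Proof. by move=> gh [c cg]; exists c => n; rewrite -gh. Qed.

Lemma computable_id : comp id.
Proof. by exists (Pair Fst Snd) => n; rewrite -(pK n); do 2 constructor. Qed.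

Lemma computable_comp g h : comp g -> comp h -> comp (fun n => g (h n)).
Proof.
by move=> [c cg] [d dh]; exists (Comp c d) => n; apply: eval_Comp (dh n) (cg _).
Qed.

Lemma computable_p1 g : comp g -> comp (fun n => p1 (g n)).
Proof.
apply: computable_comp; exists Fst => n; rewrite -{1}(pK n); constructor.
Qed.

Lemma computable_p2 g : comp g -> comp (fun n => p2 (g n)).
Proof.
apply: computable_comp; exists Snd => n; rewrite -{1}(pK n); constructor.
Qed.

Lemma computable_oracle g : comp g -> comp (fun n => x (g n)).
Proof. by apply: (@computable_comp x); exists Oracle => n; constructor. Qed.

Lemma computable_succ g : comp g -> comp (fun n => (g n).+1).
Proof. by apply: computable_comp; exists Succ => n; constructor. Qed.

Lemma computable_cst k : comp (fun=> k).
Proof.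
elim: k => [|k]; last exact: computable_succ.
by exists Zero => n; constructor.
Qed.

Lemma computable_cpair g h :
  comp g -> comp h -> comp (fun n => cpair (g n) (h n)).
Proof. by move=> [c cg] [d dh]; exists (Pair c d) => n; constructor. Qed.

Lemma computable_app2 (F : nat -> nat -> nat) g h :
  comp (fun q => F (p1 q) (p2 q)) -> comp g -> comp h ->
  comp (fun n => F (g n) (h n)).
Proof.
move=> cF cg ch; apply: computable_ext (computable_comp cF (computable_cpair cg ch)).
by move=> n; rewrite p1K p2K.
Qed.

(** Primitive recursion with parameters; the whole input [n] is the parameter,
    so the step function receives the triple of [n], counter and value. *)
Lemma computable_iteri (m b : nat -> nat) (F : nat -> nat -> nat -> nat) :
  comp m -> comp b -> comp (fun q => F (p1 q) (p1 (p2 q)) (p2 (p2 q))) ->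
  comp (fun n => iteri (m n) (F n) (b n)).
Proof.
move=> cm [c cb] [d dF].
apply: (@computable_app2 (fun n k => iteri k (F n) (b n)) id m) => //.
  exists (Prec c d) => n; rewrite -{1}(pK n).
  elim: (p2 n) => [|k IHk] /=; first by constructor.
  by apply: eval_PrecS IHk _; have := dF (cpair (p1 n) (cpair k
    (iteri k (F (p1 n)) (b (p1 n))))); rewrite !(p1K, p2K).
exact: computable_id.
Qed.

Lemma computable_if (b : nat -> bool) g h : comp b -> comp g -> comp h ->
  comp (fun n => if b n then g n else h n).
Proof.
move=> cb cg ch.
apply: (@computable_ext (fun n => iteri (b n) (fun _ _ => g n) (h n))).
  by move=> n; case: (b n).
apply: (@computable_iteri (fun n => b n) h (fun n _ _ => g n)) => //.
exact: computable_comp cg (computable_p1 computable_id).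
Qed.

Lemma computable_pred g : comp g -> comp (fun n => (g n).-1).
Proof.
apply: (@computable_comp predn).
apply: (@computable_ext (fun n => iteri n (fun i _ => i) 0)); first by case.
apply: (@computable_iteri id (fun=> 0) (fun _ i _ => i)).
- exact: computable_id.
- exact: computable_cst.
- exact/computable_p1/computable_p2/computable_id.
Qed.

Lemma computable_iter (m b : nat -> nat) (F : nat -> nat -> nat) :
  comp m -> comp b -> comp (fun q => F (p1 q) (p2 q)) ->
  comp (fun n => iter (m n) (F n) (b n)).
Proof.
move=> cm cb cF.
apply: (@computable_ext (fun n => iteri (m n) (fun _ => F n) (b n))).
  by move=> n; elim: (m n) => //= k ->.
apply: (@computable_iteri m b (fun n _ r => F n r)) => //.
apply: computable_app2 => //; do ?apply: computable_p2; last exact: computable_id.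
exact/computable_p1/computable_id.
Qed.

Lemma computable_add g h : comp g -> comp h -> comp (fun n => g n + h n).
Proof.
apply: (@computable_app2 addn); apply: (@computable_ext
  (fun q => iter (p1 q) S (p2 q))); first by move=> q; rewrite iter_succn addnC.
apply: (@computable_iter p1 p2 (fun _ => S)).
- exact/computable_p1/computable_id.
- exact/computable_p2/computable_id.
- exact/computable_succ/computable_p2/computable_id.
Qed.

Lemma computable_sub g h : comp g -> comp h -> comp (fun n => g n - h n).
Proof.
apply: (@computable_app2 subn); apply: (@computable_ext
  (fun q => iter (p2 q) predn (p1 q))); first by move=> q; rewrite iter_predn.
apply: (@computable_iter p2 p1 (fun _ => predn)).
- exact/computable_p2/computable_id.
- exact/computable_p1/computable_id.
- exact/computable_pred/computable_p2/computable_id.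
Qed.

Lemma computable_sum (m : nat -> nat) (F : nat -> nat -> nat) :
  comp m -> comp (fun q => F (p1 q) (p2 q)) ->
  comp (fun n => \sum_(0 <= i < m n) F n i).
Proof.
move=> cm cF.
apply: (@computable_ext (fun n => iteri (m n) (fun i r => r + F n i) 0)).
  move=> n; elim: (m n) => [|k IHk] /=; first by rewrite big_geq.
  by rewrite IHk big_nat_recr.
apply: (@computable_iteri m (fun=> 0) (fun n i r => r + F n i)) => //.
  exact: computable_cst.
apply: computable_add.
  exact/computable_p2/computable_p2/computable_id.
apply: computable_app2 => //; do 1?apply: computable_p1; last by
  apply/computable_p2/computable_id.
exact: computable_id.
Qed.

Lemma computable_mul g h : comp g -> comp h -> comp (fun n => g n * h n).
Proof.
apply: (@computable_app2 muln); apply: (@computable_ext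
  (fun q => \sum_(0 <= i < p1 q) p2 q)).
  by move=> q; rewrite sum_nat_const_nat subn0.
apply: (@computable_sum p1 (fun q _ => p2 q)); first exact/computable_p1/computable_id.
exact/computable_p2/computable_p1/computable_id.
Qed.

Lemma computable_expn k g : comp g -> comp (fun n => k ^ g n).
Proof.
apply: (@computable_comp (expn k)).
apply: (@computable_ext (fun n => iter n (muln k) 1)).
  by elim=> //= n ->; rewrite expnS.
apply: (@computable_iter id (fun=> 1) (fun _ => muln k)).
- exact: computable_id.
- exact: computable_cst.
- by apply: computable_mul; [exact: computable_cst|exact/computable_p2/computable_id].
Qed.

Lemma computable_eq0 g : comp g -> comp (fun n => g n == 0).
Proof.
move=> cg; apply: (@computable_ext (fun n => 1 - g n)); first by move=> n; case: (g n).
by apply: computable_sub => //; apply: computable_cst.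
Qed.

Lemma computable_leq g h : comp g -> comp h -> comp (fun n => g n <= h n).
Proof. by move=> cg ch; apply/computable_eq0/computable_sub. Qed.

Lemma computable_negb (b : nat -> bool) : comp b -> comp (fun n => ~~ b n).
Proof.
move=> cb; apply: (computable_ext _ (computable_eq0 cb)) => n.
by case: (b n).
Qed.

Lemma computable_andb (b c : nat -> bool) :
  comp b -> comp c -> comp (fun n => b n && c n).
Proof.
move=> cb cc; apply: (computable_ext _ (computable_mul cb cc)) => n.
by rewrite mulnb.
Qed.

Lemma computable_eq g h : comp g -> comp h -> comp (fun n => g n == h n).
Proof.
move=> cg ch; apply: (@computable_ext (fun n => (g n <= h n) && (h n <= g n))).
  by move=> n; rewrite eqn_leq.
by apply/computable_andb; apply/computable_leq.
Qed.

Lemma computable_eqb (b c : nat -> bool) :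
  comp b -> comp c -> comp (fun n => b n == c n).
Proof.
move=> cb cc; apply: (computable_ext _ (computable_eq cb cc)) => n.
by case: (b n); case: (c n).
Qed.

Lemma computable_has (m : nat -> nat) (P : nat -> nat -> bool) :
  comp m -> comp (fun q => P (p1 q) (p2 q)) ->
  comp (fun n => has (P n) (iota 0 (m n))).
Proof.
move=> cm cP; apply: (@computable_ext (fun n => 0 < \sum_(0 <= i < m n) P n i)).
  move=> n; congr (nat_of_bool _).
  rewrite lt0n; apply/idP/hasP.
    move=> /eqP s0; case E: (has (P n) (iota 0 (m n))).
      by move/hasP: E.
    case: s0; rewrite big_nat big1 // => i im; case Pi: (P n i) => //.
    by move/hasPn: E => /(_ i); rewrite mem_iota Pi => /(_ im).
  move=> [i]; rewrite mem_iota => im Pi; rewrite (bigD1_seq i) ?iota_uniq //=.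
    by rewrite Pi.
  by rewrite mem_index_iota.
apply: computable_leq; first exact: computable_cst.
exact: (@computable_sum m (fun n i => P n i : nat)).
Qed.

Lemma computable_all (m : nat -> nat) (P : nat -> nat -> bool) :
  comp m -> comp (fun q => P (p1 q) (p2 q)) ->
  comp (fun n => all (P n) (iota 0 (m n))).
Proof.
move=> cm cP.
apply: (@computable_ext (fun n => ~~ has (fun i => ~~ P n i) (iota 0 (m n)))).
  by move=> n; rewrite -all_predC; congr nat_of_bool; apply: eq_all => i /=; rewrite negbK.
apply/computable_negb/(@computable_has m (fun n i => ~~ P n i)) => //.
exact: computable_negb.
Qed.

Lemma computable_maxn g h : comp g -> comp h -> comp (fun n => maxn (g n) (h n)).
Proof.
move=> cg ch; apply: (@computable_ext (fun n => g n + (h n - g n))).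
  by move=> n; rewrite maxnE.
by apply: computable_add => //; apply: computable_sub.
Qed.

Lemma computable_max (m : nat -> nat) (F : nat -> nat -> nat) :
  comp m -> comp (fun q => F (p1 q) (p2 q)) ->
  comp (fun n => \max_(0 <= i < m n) F n i).
Proof.
move=> cm cF.
apply: (@computable_ext (fun n => iteri (m n) (fun i r => maxn r (F n i)) 0)).
  move=> n; elim: (m n) => [|k IHk] /=; first by rewrite big_geq.
  by rewrite IHk big_nat_recr.
apply: (@computable_iteri m (fun=> 0) (fun n i r => maxn r (F n i))) => //.
  exact: computable_cst.
apply: computable_maxn.
  exact/computable_p2/computable_p2/computable_id.
apply: computable_app2 => //; do 1?apply: computable_p1; last by
  apply/computable_p2/computable_id.
exact: computable_id.
Qed.

Lemma computable_div g h : comp g -> comp h -> comp (fun n => g n %/ h n).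
Proof.
apply: (@computable_app2 divn); apply: (@computable_ext
  (fun q => \sum_(0 <= i < p1 q) ((0 < p2 q) && (i.+1 * p2 q <= p1 q)))).
  move=> q; set m := p1 q; set d := p2 q.
  have [->|d0] := posnP d; first by rewrite divn0 big1 // => i; rewrite ltnn.
  rewrite big_mkord -[RHS]card_ord -sum1_card (big_ord_widen m (fun=> 1)) ?leq_div //.
  by rewrite [RHS]big_mkcond; apply: eq_bigr => i _; rewrite leq_divRL //; case: ifP.
apply: (@computable_sum p1 (fun q i => (0 < p2 q) && (i.+1 * p2 q <= p1 q))).
  exact/computable_p1/computable_id.
apply: computable_andb; apply: computable_leq.
- exact: computable_cst.
- exact/computable_p2/computable_p1/computable_id.
- by apply: computable_mul; [apply: computable_succ|]; apply: computable_p2;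
    try apply: computable_p1; apply: computable_id.
- exact/computable_p1/computable_p1/computable_id.
Qed.

Lemma computable_odd g : comp g -> comp (fun n => odd (g n)).
Proof.
move=> cg; apply: (@computable_ext (fun n => g n - 2 * (g n %/ 2))).
  by move=> n; have := odd_double_half (g n); lia.
by apply: computable_sub => //; apply: computable_mul;
  [exact: computable_cst|apply: computable_div => //; exact: computable_cst].
Qed.

Lemma computable_search (P : nat -> nat -> bool) (m : nat -> nat) :
  comp (fun q => P (p1 q) (p2 q)) ->
  (forall n, P n (m n)) -> (forall n i, P n i -> m n <= i) -> comp m.
Proof.
move=> /computable_negb [c cP] Pm mP; exists (Mu c) => n.
apply: (@eval_Mu _ _ _ _ (fun=> 0)).
  move=> i im; have := cP (cpair n i); rewrite p1K p2K.
  by case Pi: (P n i) => //=; move/mP: Pi; rewrite leqNgt im.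
by have := cP (cpair n (m n)); rewrite p1K p2K Pm.
Qed.

(** The finitely many values below [n0] are hard-coded into the program one at
    a time, so that finding the program from [g] need not be effective. *)
Lemma computable_eventually (g : nat -> nat) k n0 :
  (forall n, n0 <= n -> g n = k) -> comp g.
Proof.
elim: n0 g => [|n0 IH] g gk.
  by apply: (computable_ext _ (computable_cst k)) => n; rewrite gk.
apply: (@computable_ext (fun n => if n == n0 then g n0 else
    (if n == n0 then k else g n))).
  by move=> n; case: eqP => // ->.
apply: computable_if; [|exact: computable_cst|].
  by apply: computable_eq; [exact: computable_id|exact: computable_cst].
apply: IH => n n0n; case: eqP => // /eqP nn0; apply: gk.
by rewrite ltn_neqAle eq_sym nn0.
Qed.

End Closure.

(** Applies the closure lemmas along the syntax of the function, and leaves the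
    subexpressions that it does not recognise as goals. *)
Ltac computability :=
  lazymatch goal with
  | |- computable _ (fun n => n) => exact: computable_id
  | |- computable ?x p1 => exact: (computable_p1 (computable_id x))
  | |- computable ?x p2 => exact: (computable_p2 (computable_id x))
  | |- computable _ (fun n => nat_of_bool (odd (@?g n))) =>
      apply: (@computable_odd _ g); computability
  | |- computable _ (fun n => nat_of_bool (~~ (@?b n))) =>
      apply: (@computable_negb _ b); computability
  | |- computable _ (fun n => nat_of_bool (@?b n && @?c n)) =>
      apply: (@computable_andb _ b c); computability
  | |- computable _ (fun n => nat_of_bool (@?g n <= @?h n)) =>
      apply: (@computable_leq _ g h); computability
  | |- computable _ (fun n => nat_of_bool (eq_op (@?g n) (@?h n))) =>
      first [apply: (@computable_eq _ g h) | apply: (@computable_eqb _ g h)];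
      computability
  | |- computable _ (fun n => nat_of_bool (has (@?P n) (iota 0 (@?m n)))) =>
      apply: (@computable_has _ m P); computability
  | |- computable _ (fun n => nat_of_bool (all (@?P n) (iota 0 (@?m n)))) =>
      apply: (@computable_all _ m P); computability
  | |- computable _ (fun n => match @?b n with true => @?g n | false => @?h n end) =>
      apply: (@computable_if _ b g h); computability
  | |- computable _ (fun n => p1 (@?g n)) =>
      apply: (@computable_p1 _ g); computability
  | |- computable _ (fun n => p2 (@?g n)) =>
      apply: (@computable_p2 _ g); computability
  | |- computable _ (fun n => cpair (@?g n) (@?h n)) =>
      apply: (@computable_cpair _ g h); computability
  | |- computable _ (fun n => iteri (@?m n) (@?F n) (@?b n)) =>
      apply: (@computable_iteri _ m b F); computability
  | |- computable _ (fun n => iter (@?m n) (@?F n) (@?b n)) =>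
      apply: (@computable_iter _ m b F); computability
  | |- computable _ (fun n => (@?g n).-1) =>
      apply: (@computable_pred _ g); computability
  | |- computable _ (fun n => @?g n + @?h n) =>
      apply: (@computable_add _ g h); computability
  | |- computable _ (fun n => @?g n - @?h n) =>
      apply: (@computable_sub _ g h); computability
  | |- computable _ (fun n => @?g n * @?h n) =>
      apply: (@computable_mul _ g h); computability
  | |- computable _ (fun n => @?g n %/ @?h n) =>
      apply: (@computable_div _ g h); computability
  | |- computable _ (fun n => ?k ^ @?g n) =>
      apply: (@computable_expn _ k g); computability
  | |- computable _ (fun n => bigop.body _ _ (@?B n)) =>
      first [apply: computable_sum | apply: computable_max]; computability
  | |- computable _ (fun n => (@?g n).+1) =>
      apply: (@computable_succ _ g); computability
  | |- computable _ (fun=> ?k) => exact: computable_cst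
  | |- _ => try assumption
  end.

(** * A universal machine with a step counter *)

(* Unification must not evaluate pairs of numerals, such as the tags below. *)
#[local] Opaque cpair p1 p2.

(** The machine works on a value and a stack of frames, all coded as numbers;
    [0] is the empty stack.  A frame is a pair of a tag and its data. *)
Definition push a k := (cpair a k).+1.

(** One step, for the frame with tag [t] and data [r] on top of the stack [k],
    the current value [v] and the whole state [q].  Frames with tags 0 to 8 are
    codes, to be applied to [v].  Tags 9 and 10 are the two continuations of
    [Pair], 11 that of [Prec] and 12 that of [Mu].  Tag 13 checks that [r] is
    the number of a code; a machine that meets anything else on the way stays in
    the state [q] for ever, with a nonempty stack.  The simulated oracle is
    empty. *)
Definition dispatch v t r k q :=
  if t == 0 then cpair 0 k else
  if t == 1 then cpair v.+1 k else
  if t == 2 then cpair (p1 v) k else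
  if t == 3 then cpair (p2 v) k else
  if t == 4 then cpair 0 k else
  if t == 5 then cpair v (push (p1 r) (push (cpair 9 (cpair (p2 r) v)) k)) else
  if t == 6 then cpair v (push (p2 r) (push (p1 r) k)) else
  if t == 7 then
    if p2 v == 0 then cpair (p1 v) (push (p1 r) k)
    else cpair (cpair (p1 v) (p2 v).-1)
      (push (cpair 7 r) (push (cpair 11 (cpair (p2 r) v)) k)) else
  if t == 8 then
    cpair (cpair v 0) (push r (push (cpair 12 (cpair r (cpair v 0))) k)) else
  if t == 9 then cpair (p2 r) (push (p1 r) (push (cpair 10 v) k)) else
  if t == 10 then cpair (cpair r v) k else
  if t == 11 then
    cpair (cpair (p1 (p2 r)) (cpair (p2 (p2 r)).-1 v)) (push (p1 r) k) else
  if t == 12 then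
    if v == 0 then cpair (p2 (p2 r)) k
    else let ai := cpair (p1 (p2 r)) (p2 (p2 r)).+1 in
      cpair ai (push (p1 r) (push (cpair 12 (cpair (p1 r) ai)) k)) else
  if t == 13 then
    if p1 r <= 4 then if p2 r == 0 then cpair v k else q else
    if p1 r <= 7 then
      cpair v (push (cpair 13 (p1 (p2 r))) (push (cpair 13 (p2 (p2 r))) k)) else
    if p1 r == 8 then cpair v (push (cpair 13 (p2 r)) k) else q
  else q.

Definition step q :=
  let: fr := p1 (p2 q).-1 in
  if p2 q == 0 then q
  else dispatch (p1 q) (p1 fr) (p2 fr) (p2 (p2 q).-1) q.

(** The value plus one if there is a result after [s] steps, and [0] otherwise.
    The check comes first because an evaluation can terminate without having
    looked at all subprograms, while only numbers of codes may count. *)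
Definition run e n s :=
  let q := iter s step (cpair n (push (cpair 13 e) (push e 0))) in
  if p2 q == 0 then (p1 q).+1 else 0.

Arguments step : simpl never.

Lemma computable_run x (e n s : nat -> nat) :
  computable x e -> computable x n -> computable x s ->
  computable x (fun q => run (e q) (n q) (s q)).
Proof.
move=> ce cn cs; rewrite /run /push.
have cstep : computable x step by rewrite /step /dispatch /push /=; computability.
have ci : computable x (fun q => iter (s q) step
    (cpair (n q) (cpair (cpair 13 (e q)) (cpair (e q) 0).+1).+1)).
  apply: (@computable_iter x s _ (fun _ => step)) => //; first by computability.
  by apply: (computable_comp cstep); computability.
apply: computable_if; last exact: computable_cst.
  by apply/computable_eq0/computable_p2.
by apply/computable_succ/computable_p1.
Qed.

Lemma cpair_push0 v w a k : cpair v (push a k) <> cpair w 0.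
Proof. by move=> /cpair_inj []. Qed.

Lemma iter_fix T (g : T -> T) s q : g q = q -> iter s g q = q.
Proof. by move=> gq; elim: s => //= s ->. Qed.

Lemma step_halted v : step (cpair v 0) = cpair v 0.
Proof. by rewrite /step p2K. Qed.

Lemma run_mono e n s t v : s <= t -> run e n s = v.+1 -> run e n t = v.+1.
Proof.
move=> st; rewrite /run -(subnK st) iterD.
set q := iter s _ _ => /=; case: (p2 q =P 0) => // q0 [<-].
have -> : q = cpair (p1 q) 0 by rewrite -q0 pK.
by rewrite iter_fix ?step_halted // p2K !p1K.
Qed.

Lemma step_push v t r k : step (cpair v (push (cpair t r) k)) =
  dispatch v t r k (cpair v (push (cpair t r) k)).
Proof. by rewrite /step /push !p2K /= !p1K !p2K. Qed.

Ltac stepE := rewrite step_push /dispatch /= ?(p1K, p2K) /=.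

Definition reach q q' := exists s, iter s step q = q'.

Lemma reach_trans q1 q2 q3 : reach q1 q2 -> reach q2 q3 -> reach q1 q3.
Proof. by move=> [s <-] [t <-]; exists (t + s); rewrite iterD. Qed.

Lemma reach_step q q' : reach (step q) q' -> reach q q'.
Proof. by move=> [s <-]; exists s.+1; rewrite iterSr. Qed.

Lemma reach_eval c n v k :
  eval emptyset c n v -> reach (cpair n (push (encode c) k)) (cpair v k).
Proof.
have nil q : reach q q by exists 0.
move=> cv; elim: cv k => {c n v}.
1-5: by move=> *; apply: reach_step; stepE.
- move=> c d n u v _ IHc _ IHd k; apply: reach_step; stepE.
  apply: reach_trans (IHc _) _; apply: reach_step; stepE.
  by apply: reach_trans (IHd _) _; apply: reach_step; stepE.
- move=> c d n u v _ IHd _ IHc k; apply: reach_step; stepE.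
  by apply: reach_trans (IHd _) _; apply: reach_trans (IHc _) _.
- by move=> c d a v _ IHc k; apply: reach_step; stepE; apply: IHc.
- move=> c d a n u v _ IH _ IHd k; apply: reach_step; stepE.
  apply: reach_trans (IH _) _; apply: reach_step; stepE.
  by apply: IHd.
- move=> c a m u _ IHi _ IH0 k; apply: reach_step; stepE.
  (* The search is followed backwards from its end: [j] tests remain. *)
  have loop j : j <= m -> reach
    (cpair (cpair a (m - j)) (push (encode c) (push (cpair 12
      (cpair (encode c) (cpair a (m - j)))) k))) (cpair m k).
    elim: j => [|j IHj] jm.
      by rewrite subn0; apply: reach_trans (IH0 _) _; apply: reach_step; stepE.
    apply: reach_trans (IHi (m - j.+1) _ _) _; first by lia.
    apply: reach_step; stepE.
    by have := IHj (ltnW jm); rewrite -subSn //.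
  by have := loop m (leqnn m); rewrite subnn.
Qed.

Lemma reach_check c v k : reach (cpair v (push (cpair 13 (encode c)) k)) (cpair v k).
Proof.
have nil q : reach q q by exists 0.
elim: c k => [||||| c IHc d IHd | c IHc d IHd | c IHc d IHd | c IHc] k;
  apply: reach_step; stepE => //.
1-3: by apply: reach_trans (IHc _) _; apply: IHd.
Qed.

Lemma eval_run c n v : eval emptyset c n v -> exists s, run (encode c) n s = v.+1.
Proof.
move=> cv.
have [s sE] := reach_trans (reach_check c n (push (encode c) 0)) (reach_eval 0 cv).
by exists s; rewrite /run sE p1K p2K.
Qed.

(** The machine is deterministic and stops only with an empty stack, so a
    computation that stops has to dispose of the top frame on its way.  Strong
    induction on the number of steps applies to the pieces. *)
Lemma check_inv s e v k w :
  iter s step (cpair v (push (cpair 13 e) k)) = cpair w 0 ->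
  (exists c, encode c = e) /\
  exists2 s', s' < s & iter s' step (cpair v k) = cpair w 0.
Proof.
elim/ltn_ind: s e k => -[|s] IH e k; first by move=> /cpair_push0.
set q := cpair v _ => sE.
have nfix : step q <> q.
  move=> qE; have := iter_fix s.+1 qE.
  by rewrite sE /q => /esym /cpair_push0.
move: sE nfix; rewrite iterSr /q -(pK e); move: (p1 e) (p2 e) => {q e} t r.
case: t => [|[|[|[|[|[|[|[|[|t]]]]]]]]]; stepE.
1-5: case: r => [|r] //= sE _; split; last by exists s.
1: by exists Zero.
1: by exists Succ.
1: by exists Fst.
1: by exists Snd.
1: by exists Oracle.
1-3: move=> sE _;
  have [[c cE] [s1 s1s {}sE]] := IH s (leqnn _) _ _ sE;
  have [[d dE] [s2 s2s {}sE]] := IH s1 (ltnW s1s) _ _ sE;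
  (split; last by exists s2 => //; lia); rewrite -[r]pK -cE -dE.
1: by exists (Pair c d).
1: by exists (Comp c d).
1: by exists (Prec c d).
1: move=> sE _; have [[c cE] [s1 s1s {}sE]] := IH s (leqnn _) _ _ sE.
1: by split; [exists (Mu c); rewrite -cE | exists s1 => //; lia].
by move=> _ nE; case: nE.
Qed.

Lemma eval_step_inv s c n k w :
  iter s step (cpair n (push (encode c) k)) = cpair w 0 ->
  exists2 s', s' < s & exists2 v, eval emptyset c n v &
    iter s' step (cpair v k) = cpair w 0.
Proof.
elim/ltn_ind: s c n k => -[|s] IH c n k; first by move=> /cpair_push0.
rewrite iterSr; case: c => [||||| c d | c d | c d | c]; stepE.
1-5: move=> sE; exists s => //; eexists; last exact: sE.
- exact: eval_Zero.
- exact: eval_Succ.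
- by rewrite -{1}(pK n); apply: eval_Fst.
- by rewrite -{1}(pK n); apply: eval_Snd.
- exact: (@eval_Oracle emptyset).
- move=> /IH [//|s1 s1s [u cu]]; case: s1 s1s => [|s1] s1s; first by move=> /cpair_push0.
  rewrite iterSr; stepE.
  move=> /IH [|s2 s2s [v dv]]; first by lia.
  case: s2 s2s => [|s2] s2s; first by move=> /cpair_push0.
  rewrite iterSr; stepE => sE.
  by exists s2; [lia | exists (cpair u v) => //; apply: eval_Pair].
- move=> /IH [//|s1 s1s [u du]] /IH [|s2 s2s [v cv sE]]; first by lia.
  by exists s2; [lia | exists v => //; apply: eval_Comp du cv].
- have [a [m ->]] : exists a m, n = cpair a m by exists (p1 n), (p2 n); rewrite pK.
  rewrite p1K p2K; case: m => [|m] /=.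
    move=> /IH [//|s1 s1s [u cu sE]].
    by exists s1; [lia | exists u => //; apply: eval_Prec0].
  move=> /(IH _ _ (Prec c d)) [//|s1 s1s [u cu]].
  case: s1 s1s => [|s1] s1s; first by move=> /cpair_push0.
  rewrite iterSr; stepE.
  move=> /IH [|s2 s2s [v dv sE]]; first by lia.
  by exists s2; [lia | exists v => //; apply: eval_PrecS cu dv].
- have loop s' i : s' <= s -> iter s' step
      (cpair (cpair n i) (push (encode c) (push (cpair 12
      (cpair (encode c) (cpair n i))) k))) = cpair w 0 ->
    exists2 s1, s1 < s' & exists m,
      [/\ forall j, i <= j < m -> exists u, eval emptyset c (cpair n j) u.+1,
          eval emptyset c (cpair n m) 0 &
          iter s1 step (cpair m k) = cpair w 0].
    elim/ltn_ind: s' i => s' IHs i s's /IH [|s1 s1s [u cu]]; first by lia.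
    case: s1 s1s => [|s1] s1s; first by move=> /cpair_push0.
    rewrite iterSr; stepE; case: u cu => [|u] cu /=.
      move=> sE; exists s1; first by lia.
      by exists i; split => // j; lia.
    move=> /IHs [||s2 s2s [m [lt ge sE]]]; [lia|lia|].
    exists s2; first by lia.
    exists m; split=> // j /andP[]; rewrite leq_eqVlt => /orP[/eqP <- _|ij jm].
      by exists u.
    by apply: lt; rewrite ij jm.
  move=> /loop [//|s1 s1s [m [lt ge sE]]].
  exists s1; first by lia.
  exists m => //.
  have /boolp.choice[u uP] j : exists u, j < m -> eval emptyset c (cpair n j) u.+1.
    by have [/lt[u ?]|_] := ltnP j m; [exists u|exists 0].
  exact: eval_Mu uP ge.
Qed.

Lemma run_eval e n s v :
  run e n s = v.+1 -> exists2 c, encode c = e & eval emptyset c n v.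
Proof.
rewrite /run; set q := iter _ _ _; case: eqP => // q0 [qv].
have : q = cpair v 0 by rewrite -(pK q) qv q0.
move=> /check_inv [[c ce] [s1 _]]; rewrite -ce => /eval_step_inv.
move=> [s2 _ [u cu]]; rewrite iter_fix ?step_halted // => /cpair_inj [<- _].
by exists c.
Qed.

Lemma encode_inj : injective encode.
Proof.
move=> c d; elim: c d => [||||| c IHc c' IHc' | c IHc c' IHc' | c IHc c' IHc' | c IHc].
all: case=> [||||| d d' | d d' | d d' | d] //= /cpair_inj [] // _.
1-3: by move=> /cpair_inj [] /IHc -> /IHc' ->.
by move=> /IHc ->.
Qed.

(** * The jump *)

Definition cst_prog k := iter k (Comp Succ) Zero.

Lemma eval_cst_prog x k n : eval x (cst_prog k) n k.
Proof.
elim: k => [|k IHk] /=; first exact: eval_Zero.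
exact: eval_Comp IHk (eval_Succ _ _).
Qed.

(** The search for a witness with [n] built into its program is a program
    without input; its number is a computable function of [n], and it is in the
    jump of [y] exactly if there is a witness. *)
Lemma computable_exists_jump y z (P : nat -> nat -> bool) :
  computable y (fun q => P (p1 q) (p2 q)) -> computable z (jump y) ->
  computable z (fun n => `[< exists s, P n s >]).
Proof.
move=> /computable_negb [c cP] [j jP].
pose code_of n := Comp (Mu c) (cst_prog n).
have cE k m : eval y c (cpair k m) (~~ P k m).
  by have := cP (cpair k m); rewrite p1K p2K.
have codeP n : jump y (encode (code_of n)) = `[< exists s, P n s >].
  apply: asbool_equiv_eq; split=> [[d [v [/encode_inj ->]]]|[s Ps]].
    move=> /eval_inv [u /(eval_functional (eval_cst_prog y n _)) <- /eval_inv [_ ev]].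
    by exists v; have := eval_functional ev (cE n v); case: (P n v).
  have exP : exists s, P n s by exists s.
  exists (code_of n), (ex_minn exP); split=> //.
  apply: eval_Comp (eval_cst_prog _ _ _) _; case: ex_minnP => m Pm minm.
  apply: (@eval_Mu _ _ _ _ (fun=> 0)); last by have := cE n m; rewrite Pm.
  move=> i im; have := cE n i; case Pi: (P n i) => //.
  by move/minm: Pi; rewrite leqNgt im.
apply: (@computable_ext _ (fun n => jump y (encode (code_of n)))).
  by move=> n; rewrite codeP.
apply: (@computable_comp _ (fun n => jump y n)); first by exists j.
apply: (@computable_ext _ (fun n => cpair 6 (cpair (encode (Mu c))
    (iter n (fun r => cpair 6 (cpair (encode Succ) r)) (encode Zero))))).
  move=> n; rewrite /code_of [RHS]/=; congr (cpair _ (cpair _ _)).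
  by elim: n => //= n ->.
by computability.
Qed.

Definition halts e s := 0 < run e e s.

Lemma jump_halts e : jump emptyset e = `[< exists s, halts e s >].
Proof.
apply: asbool_equiv_eq; split=> [[c [v [<- /eval_run [s sE]]]]|[s]].
  by exists s; rewrite /halts sE.
rewrite /halts; case E: (run e e s) => [//|v] _.
by have [c ce cv] := run_eval E; exists c, v.
Qed.

Lemma halts_mono e s t : s <= t -> halts e s -> halts e t.
Proof.
move=> st; rewrite /halts; case E: (run e e s) => [//|v] _.
by rewrite (run_mono st E).
Qed.

Lemma computable_joinl x y : computable (join x y) x.
Proof.
apply: (@computable_ext _ (fun n => join x y (n * 2))).
  by move=> n; rewrite /join muln2 odd_double doubleK.
by apply: computable_oracle; computability.
Qed.

Lemma computable_joinr x y : computable (join x y) y.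
Proof.
apply: (@computable_ext _ (fun n => join x y (n * 2).+1)).
  by move=> n; rewrite /join muln2 /= odd_double /= uphalf_double.
by apply: computable_oracle; computability.
Qed.

Lemma computable_join z (x y : cantor) : computable z x -> computable z y ->
  computable z (join x y).
Proof.
move=> cx cy; rewrite /join.
apply: (@computable_ext _ (fun n => if odd n then y (n %/ 2) : nat else x (n %/ 2))).
  by move=> n; rewrite divn2; case: odd.
apply: computable_if; first by computability.
  by apply: (computable_comp cy); computability.
by apply: (computable_comp cx); computability.
Qed.

Lemma jump_ge_join x : jump x >=T join (jump emptyset) x.
Proof.
have cj : computable (jump x) (jump x).
  by apply: computable_oracle; apply: computable_id.
apply: computable_join.
  apply: (@computable_ext _ (fun e => `[< exists s, halts e s >])).
    by move=> e; rewrite jump_halts.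
  apply: computable_exists_jump cj; apply: computable_leq; first exact: computable_cst.
  by apply: computable_run; computability.
apply: (@computable_ext _ (fun n => `[< exists s, (fun n _ => x n) n s >])).
  by move=> n; congr nat_of_bool; apply/asboolP/idP => [[]//|xn]; exists 0.
apply: computable_exists_jump cj; apply: computable_oracle; computability.
Qed.

(** * Strings and their codes *)

(** In binary, [(str_code s).+1] is a leading 1 followed by the bits of [s] with
    the first one last; [code_size] and [code_bit] read off the string from
    this. *)
Definition code_size a := \sum_(0 <= i < a) (2 ^ i.+1 <= a.+1).
Definition code_bit a i := odd (a.+1 %/ 2 ^ i).
Definition str_of a : str := mkseq (code_bit a) (code_size a).

Lemma str_code_bounds s : 2 ^ size s <= (str_code s).+1 < 2 ^ (size s).+1.
Proof.
elim: s => [|b s IHs] //=; move: IHs; rewrite -/(str_code s) !expnS -muln2.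
by case: b; lia.
Qed.

Lemma size_str_code s : size s <= str_code s.
Proof.
have /andP[+ _] := str_code_bounds s.
by have := ltn_expl (size s) (ltnSn 1); lia.
Qed.

Lemma str_code_rcons s b : str_code (rcons s b) = str_code s + 2 ^ size s * b.+1.
Proof.
elim: s => [|c s IHs] /=; first by rewrite mul1n.
by rewrite -!/(str_code _) IHs expnS -!muln2; lia.
Qed.

Lemma code_size_str_code s : code_size (str_code s) = size s.
Proof.
have /andP[lo hi] := str_code_bounds s.
rewrite /code_size big_mkord.
under eq_bigr => i _.
  have -> : (2 ^ i.+1 <= (str_code s).+1) = (i < size s).
    apply/idP/idP => h.
      by rewrite -ltnS -(@ltn_exp2l 2) // (leq_ltn_trans h).
    by apply: leq_trans lo; rewrite leq_exp2l.
  over.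
rewrite -[RHS]card_ord -sum1_card (big_ord_widen (str_code s) (fun=> 1)) ?size_str_code //.
by rewrite [RHS]big_mkcond; apply: eq_bigr => i _; case: ifP.
Qed.

Lemma code_bit_str_code s i : i < size s -> code_bit (str_code s) i = nth false s i.
Proof.
rewrite /code_bit; elim: s i => [//|b s IHs] [|i] /=; rewrite -/(str_code s).
  by rewrite divn1 oddS oddD odd_double oddS; case: b.
rewrite ltnS => /IHs <-; rewrite expnS divnMA divn2; congr (odd (_ %/ _)).
by case: b; lia.
Qed.

Lemma str_codeK : cancel str_code str_of.
Proof.
move=> s; rewrite /str_of code_size_str_code; apply: (@eq_from_nth _ false).
  by rewrite size_mkseq.
by move=> i; rewrite size_mkseq => i_lt; rewrite nth_mkseq // code_bit_str_code.
Qed.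

Lemma str_ofK : cancel str_of str_code.
Proof.
suff surj a : exists s, str_code s = a.
  by move=> a; have [s <-] := surj a; rewrite str_codeK.
elim/ltn_ind: a => -[|a] IH; first by exists [::].
have [s sE] := IH a./2 ltac:(lia).
exists (odd a :: s); rewrite /= -/(str_code s) sE.
by have := odd_double_half a; lia.
Qed.

(** * The order of strings and sequences *)

(** The non-strict lexicographic order.  Padding a string with zeros reduces the
    order between strings and sequences to it, see [leLP]; this makes
    transitivity and totality available. *)
Definition lexle (y z : cantor) :=
  forall n, (forall i, i < n -> y i = z i) -> y n -> z n.

Lemma lexle_trans y x z : lexle x y -> lexle y z -> lexle x z.
Proof.
move=> xy yz n xz xn.
have agree m : m <= n -> forall i, i < m -> x i = y i.
  elim: m => // m IHm mn i; rewrite ltnS leq_eqVlt => /orP[/eqP ->|]; last first.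
    by apply: IHm; apply: ltnW.
  have xyi := IHm (ltnW mn); apply/idP/idP; first exact: xy.
  by rewrite xz //; apply: yz => j jm; rewrite -xyi // xz // (ltn_trans jm).
by apply: yz (xy _ (agree n _) xn) => // i in_; rewrite -(agree n) // xz.
Qed.

Lemma lexle_total y z : ~ lexle y z -> lexle z y.
Proof.
move=> /existsNP[n /not_implyP[yz /not_implyP[yn zn]]] m zy zm.
have [mn|nm|mn] := ltngtP m n.
- by rewrite yz.
- by rewrite -zy in yn.
- by rewrite mn in zm.
Qed.

Lemma leLP s y : leL s y <-> lexle (nth false s) y.
Proof.
have mk n i : i < n -> nth false (mkseq y n) i = y i by exact: nth_mkseq.
split=> [[[n [n_lt /(congr1 (nth false)) sy sn yn]]|sE] m|sy].
- move=> agree sm; have [mn|nm|->//] := ltngtP m n.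
    by rewrite -(mk n) // -sy nth_take.
  by rewrite agree // yn in sn.
- move=> _ sm; rewrite -(mk (size s)) -?sE // ltnNge; apply: contraL sm => ms.
  by rewrite nth_default.
- have [d|] := pselect (exists n, (n < size s) && (nth false s n != y n)).
    left; move: (ex_minnP d) => [n /andP[n_lt sn] n_min]; exists n.
    have agree i : i < n -> nth false s i = y i.
      move=> in_; apply/eqP/negPn/negP => si.
      have := n_min i; rewrite si (ltn_trans in_) //= => /(_ isT).
      by rewrite leqNgt in_.
    have := sy n agree; move: sn; case: (nth false s n); case: (y n) => // _.
      by move=> /(_ isT).
    move=> _; split=> //; apply: (@eq_from_nth _ false).
      by rewrite size_take size_mkseq n_lt.
    move=> i; rewrite size_take n_lt => in_.
    by rewrite nth_take // mk // agree.
  move=> /forallNP d; right; apply: (@eq_from_nth _ false).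
    by rewrite size_mkseq.
  move=> i i_lt; rewrite mk //; have := d i; rewrite i_lt /=.
  by move=> /negP /negPn /eqP.
Qed.

(** [leL] as a boolean function of the code of the string, with bounded
    quantifiers only. *)
Definition leLb (y : cantor) a :=
  all (fun n => ~~ [&& all (fun i => code_bit a i == y i) (iota 0 n),
      code_bit a n & ~~ y n])
    (iota 0 (code_size a)).

Lemma leLbP a y : reflect (leL (str_of a) y) (leLb y a).
Proof.
have nthE i : i < code_size a -> nth false (str_of a) i = code_bit a i by exact: nth_mkseq.
apply: (iffP allP) => [h|/leLP h n].
  apply/leLP => n agree an; have n_lt : n < code_size a.
    by rewrite ltnNge; apply: contraL an => ?; rewrite nth_default ?size_mkseq.
  have := h n; rewrite mem_iota n_lt -nthE // an /= => /(_ isT).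
  rewrite negb_and negbK => /orP[/allPn[i]|//]; rewrite mem_iota => /= in_.
  by rewrite -nthE ?agree ?eqxx // (ltn_trans in_).
rewrite mem_iota add0n /= => n_lt; apply/negP => /and3P[/allP agree an].
rewrite h ?nthE // => i in_; rewrite nthE ?(ltn_trans in_) //.
by apply/eqP/agree; rewrite mem_iota.
Qed.

Lemma computable_code_size x g : computable x g -> computable x (fun n => code_size (g n)).
Proof.
move=> cg; apply: (@computable_comp _ code_size) => //; rewrite /code_size; computability.
Qed.

Lemma computable_code_bit x g h : computable x g -> computable x h ->
  computable x (fun n => code_bit (g n) (h n)).
Proof. by move=> cg ch; rewrite /code_bit; computability. Qed.

Lemma computable_leLb x (Y : nat -> nat -> bool) g :
  computable x (fun q => Y (p1 q) (p2 q)) -> computable x g ->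
  computable x (fun n => leLb (Y n) (g n)).
Proof.
move=> cY cg.
apply: (@computable_app2 _ (fun n a => leLb (Y n) a : nat) id) => //; last first.
  exact: computable_id.
rewrite /leLb.
apply: (@computable_all _ (fun q => code_size (p2 q)) (fun q n =>
  ~~ [&& all (fun i => code_bit (p2 q) i == Y (p1 q) i) (iota 0 n),
      code_bit (p2 q) n & ~~ Y (p1 q) n])).
  by apply: computable_code_size; computability.
have cYq g' h : computable x g' -> computable x h ->
    computable x (fun n => Y (g' n) (h n)).
  exact: (@computable_app2 _ (fun n k => Y n k : nat)).
computability; try (by apply: computable_code_bit; computability);
 by apply: cYq; computability.
Qed.

(** * Complexity of computable strings *)

Lemma K_le M s t : M t = Some s -> le_inf (K M s) (Some (size t)).
Proof.
move=> Mt; rewrite /K; case: pselect => [ex|[]] /=.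
  by case: ex_minnP => m _; apply; apply/asboolP; exists t.
by exists (size t); apply/asboolP; exists t.
Qed.

Lemma str_code_nseq e : (str_code (nseq e false)).+1 = 2 ^ e.
Proof. by elim: e => //= e; rewrite -/(str_code _) expnS -muln2; lia. Qed.

Lemma str_code_unary s e : (str_code s).+1 = 3 * 2 ^ e -> s = rcons (nseq e false) true.
Proof.
move=> sE; apply: (can_inj str_codeK); rewrite str_code_rcons size_nseq.
by have := str_code_nseq e; lia.
Qed.

Lemma prefix_unary e e' :
  prefix (rcons (nseq e false) true) (rcons (nseq e' false) true) -> e = e'.
Proof.
move=> /prefixP[s sE]; have := congr1 size sE.
have := congr1 (nth false ^~ e) sE.
rewrite size_cat !size_rcons !size_nseq nth_cat size_rcons size_nseq ltnSn.
by rewrite !nth_rcons !size_nseq ltnn eqxx nth_nseq; case: ltngtP => //; lia.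
Qed.

(** What is computed from [n] has complexity at most [n + d]: the machine that
    maps [0^n 1] to the string with the computed code has a prefix-free domain.
    The code of [0^n 1] is [3 * 2^n - 1], so no decoding of strings is needed. *)
Lemma K_le_index U c : optimal U ->
  exists d, forall e v, eval emptyset c e v -> le_inf (K U (str_of v)) (Some (d + e)).
Proof.
move=> [_ optU].
(* [G] is the graph of the machine [M]. *)
pose G s t := exists e v,
  [/\ (str_code s).+1 = 3 * 2 ^ e, eval emptyset c e v & t = str_of v].
pose M s := if pselect (exists t, G s t) is left ex then Some (projT1 (cid ex)) else None.
have expI : injective (fun e => 3 * 2 ^ e).
  by move=> e e' /eqP; rewrite eqn_pmul2l // eqn_exp2l // => /eqP.
have MP s t : M s = Some t <-> G s t.
  rewrite /M; case: pselect => [ex|nex]; last first.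
    by split=> // Gt; case: nex; exists t.
  case: cid => u Gu /=; split=> [[<-]//|[e [v [sE cv ->]]]].
  congr Some; case: Gu => e' [v' [+ + ->]]; rewrite sE => /expI <- cv'.
  by rewrite (eval_functional cv cv').
have [w wP] : computable emptyset
    (fun q => ~~ ((p1 q).+1 == 3 * 2 ^ p2 q)) by computability.
have pM : prefix_free_machine M.
  split; last first.
    move=> s t; case Ms: (M s) => [u|//] _; case Mt: (M t) => [u'|//] _.
    move/MP: Ms => [e [v [/str_code_unary -> _ _]]].
    by move/MP: Mt => [e' [v' [/str_code_unary -> _ _]]] /prefix_unary ->.
  exists (Comp c (Mu w)) => s v; split=> [/eval_inv [e /eval_inv [_ e0] cv]|].
    have -> : M s = Some (str_of v); last by rewrite /= str_ofK.
    apply/MP; exists e, v; split=> //.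
    have := eval_functional e0 (wP _); rewrite p1K p2K.
    by case: eqP.
  case Ms: (M s) => [t|//] [<-]; move/MP: Ms => [e [u [sE cu ->]]].
  rewrite str_ofK; apply: eval_Comp cu; apply: (@eval_Mu _ _ _ _ (fun=> 0)).
    move=> i ie; have := wP (cpair (str_code s) i); rewrite p1K p2K sE.
    by case: eqP => // /expI ei; rewrite ei ltnn in ie.
  by have := wP (cpair (str_code s) e); rewrite p1K p2K sE eqxx.
have [d dP] := optU M pM; exists d.+1 => e v cv.
have /K_le : M (rcons (nseq e false) true) = Some (str_of v).
  apply/MP; exists e, v; split => //; rewrite str_code_rcons size_nseq.
  by have := str_code_nseq e; lia.
have := dP (str_of v); case: (K M _) => [k|//]; case: (K U _) => [l|//] /=.
by rewrite size_rcons size_nseq; lia.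
Qed.

Lemma code_size_le a : code_size a <= a.
Proof. by rewrite -[a]str_ofK code_size_str_code size_str_code. Qed.

(** * Approximation of the function by stages *)

Section Stages.
Variables (U : machine) (e : nat).
Hypothesis eU : forall p v,
  (exists s, run e p s = v.+1) <-> omap str_code (U (str_of p)) = Some v.

(** The numerator over [2^s] of the contribution [2^-K] of the string with code
    [a], where only the programs that have stopped by stage [s] are taken into
    account. *)
Definition stage_num s a :=
  \max_(0 <= p < s) (if run e p s == a.+1 then 2 ^ (s - code_size p) else 0).

Definition f_num y s := \sum_(0 <= a < s) (if leLb y a then stage_num s a else 0).

Lemma run_U p a s : run e p s = a.+1 -> U (str_of p) = Some (str_of a).
Proof.
move=> ps; have /eU : exists s, run e p s = a.+1 by exists s.
by case: (U _) => //= t [<-]; rewrite str_codeK.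
Qed.

Lemma stage_num_ge s a p :
  p < s -> run e p s = a.+1 -> 2 ^ (s - code_size p) <= stage_num s a.
Proof.
by move=> ps pa; rewrite /stage_num big_mkord (bigmax_sup (Ordinal ps)) // pa eqxx.
Qed.

Lemma stage_numP s a : stage_num s a = 0 \/
  exists p, [/\ p < s, run e p s = a.+1 & stage_num s a = 2 ^ (s - code_size p)].
Proof.
have : stage_num s a = 0 \/
  exists p, [/\ p < s, p \in iota 0 s, run e p s = a.+1 &
    stage_num s a = 2 ^ (s - code_size p)].
  rewrite /stage_num big_seq; elim/big_ind: _.
  - by left.
  - by move=> m n hm hn; case: (leqP m n) => _.
  - move=> p; rewrite mem_index_iota => ps; case: eqP => pa; [right|by left].
    by exists p; rewrite mem_iota.
by case=> [->|[p [? _ ? ?]]]; [left|right; exists p].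
Qed.

End Stages.

Section Approx.
Import Order.TTheory GRing.Theory Num.Theory.
Local Open Scope ring_scope.
Variables (R : realType) (U : machine) (e : nat).
Hypothesis eU : forall p v,
  (exists s, run e p s = v.+1) <-> omap str_code (U (str_of p)) = Some v.

Definition stage_wt s a : R := (stage_num e s a)%:R / 2 ^+ s.

Definition final_wt a : R := exp2N R (K U (str_of a)).

Lemma two_gt0 n : 0 < 2 ^+ n :> R.
Proof. by rewrite exprn_gt0. Qed.

Lemma natr_exp2 n : (2 ^ n)%N%:R = 2 ^+ n :> R.
Proof. by rewrite natrX. Qed.

Lemma stage_wt_exp s p :
  (p < s)%N -> (2 ^ (s - code_size p))%N%:R / 2 ^+ s = 2 ^- code_size p :> R.
Proof.
move=> ps; have ls : (code_size p <= s)%N by rewrite (leq_trans (code_size_le p)) // ltnW.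
by rewrite natr_exp2 -{2}(subnK ls) exprD invfM mulrA divff ?mul1r.
Qed.

Lemma stage_wt_ge0 s a : 0 <= stage_wt s a.
Proof. by rewrite divr_ge0 // ltW // two_gt0. Qed.

Lemma exp2N_le (k l : nat) : (k <= l)%N -> 2 ^- l <= 2 ^- k :> R.
Proof. by move=> kl; rewrite lef_pV2 ?posrE ?two_gt0 // ler_eXn2l // ltr1n. Qed.

Lemma stage_wt_ge_program s a p :
  (p < s)%N -> run e p s = a.+1 -> 2 ^- code_size p <= stage_wt s a.
Proof.
move=> ps pa; rewrite -(stage_wt_exp ps) ler_pM2r ?invr_gt0 ?two_gt0 // ler_nat.
exact: stage_num_ge.
Qed.

Lemma stage_wt_mono s t a : (s <= t)%N -> stage_wt s a <= stage_wt t a.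
Proof.
move=> st; have [w0|[p [ps pa wE]]] := stage_numP e s a.
  by rewrite /stage_wt w0 mul0r stage_wt_ge0.
rewrite {1}/stage_wt wE stage_wt_exp //; apply: stage_wt_ge_program (run_mono st pa).
exact: leq_trans ps st.
Qed.

Lemma stage_wt_le_final s a : stage_wt s a <= final_wt a.
Proof.
have [w0|[p [ps pa wE]]] := stage_numP e s a.
  by rewrite /stage_wt w0 mul0r exp2N_ge0.
rewrite /stage_wt wE stage_wt_exp // /final_wt.
have /K_le := run_U eU pa; rewrite size_mkseq.
by case: (K U _) => [k|//] /= kl; apply: exp2N_le.
Qed.

Lemma stage_wt_final a : exists s0, forall s, (s0 <= s)%N -> stage_wt s a = final_wt a.
Proof.
case E : (K U (str_of a)) => [k|]; last first.
  exists 0%N => s _; apply/le_anti; rewrite stage_wt_le_final /=.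
  by rewrite /final_wt E stage_wt_ge0.
have [t [Ut tk]] := K_program E.
have [s sP] : exists s, run e (str_code t) s = a.+1.
  by apply/eU; rewrite str_codeK Ut /= str_ofK.
exists (maxn s (str_code t).+1) => u; rewrite geq_max => /andP[su tu].
apply/le_anti; rewrite stage_wt_le_final /= /final_wt E /= -tk -code_size_str_code.
exact: stage_wt_ge_program (run_mono su sP).
Qed.

Lemma stage_wt_final_all n :
  exists s0, forall s a, (s0 <= s)%N -> (a < n)%N -> stage_wt s a = final_wt a.
Proof.
elim: n => [|n [s0 s0P]]; first by exists 0%N.
have [s1 s1P] := stage_wt_final n; exists (maxn s0 s1) => s a.
rewrite geq_max ltnS [(a <= n)%N]leq_eqVlt => /andP[s0s s1s] /orP[/eqP ->|an].
  exact: s1P.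
exact: s0P.
Qed.

Definition f_stage y s : R := (f_num e y s)%:R / 2 ^+ s.

Lemma f_stageE y s : f_stage y s = \sum_(0 <= a < s | leLb y a) stage_wt s a.
Proof.
rewrite /f_stage /f_num natr_sum mulr_suml [RHS]big_mkcond /=.
by apply: eq_bigr => a _; case: ifP => // _; rewrite mul0r.
Qed.

Lemma f_series y : f R U y = (\sum_(a <oo | leLb y a) (final_wt a)%:E)%E.
Proof.
rewrite nneseries_esum => [|a _]; last by rewrite lee_fin exp2N_ge0.
rewrite /f (reindex_esum [set a | leLb y a] _ str_of) //.
split.
- by move=> a /= /leLbP.
- by move=> a b _ _ /(can_inj str_ofK).
- move=> s sy; exists (str_code s); rewrite ?str_codeK //=.
  by apply/leLbP; rewrite str_codeK.
Qed.

Lemma ler_sum_split y s t (v w : nat -> R) : (s <= t)%N ->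
  (forall a, v a <= w a) -> (forall a, 0 <= w a) ->
  \sum_(0 <= a < s | leLb y a) v a <= \sum_(0 <= a < t | leLb y a) w a.
Proof.
move=> st vw w0; rewrite (big_cat_nat _ st) //=.
rewrite -[leLHS]addr0 lerD // ?sumr_ge0 //.
exact: ler_sum.
Qed.

Lemma f_stage_le_f y s : ((f_stage y s)%:E <= f R U y)%E.
Proof.
rewrite f_series f_stageE.
apply: (@le_trans _ _ (\sum_(0 <= a < s | leLb y a) (final_wt a)%:E)%E).
  by rewrite sumEFin lee_fin ler_sum // => a _; apply: stage_wt_le_final.
by apply: nneseries_lim_ge => a _ _; rewrite lee_fin exp2N_ge0.
Qed.

(** Each partial sum of [f(y)] involves finitely many strings, whose complexity
    is known exactly from some stage on. *)
Lemma f_le_bound y t0 (B : R) : (forall t, (t0 <= t)%N -> f_stage y t <= B) ->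
  (f R U y <= B%:E)%E.
Proof.
move=> f_stageB; rewrite f_series; apply: lime_le.
  by apply: is_cvg_nneseries => a _ _; rewrite lee_fin exp2N_ge0.
apply: nearW => n; rewrite sumEFin lee_fin.
have [s0 s0P] := stage_wt_final_all n.
pose t := maxn n (maxn s0 t0).
have nt : (n <= t)%N by rewrite leq_maxl.
have s0t : (s0 <= t)%N by rewrite !leq_max leqnn orbT.
apply: le_trans (f_stageB t _); last by rewrite !leq_max leqnn !orbT.
rewrite f_stageE big_nat_cond (eq_bigr (stage_wt t)) => [|a /andP[/andP[_ an] _]].
  rewrite -big_nat_cond; apply: ler_sum_split => // a; exact: stage_wt_ge0.
by rewrite s0P.
Qed.

(** What is added between two stages is a sum of nonnegative terms over the
    strings below the given sequence, hence monotone in that set. *)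
Lemma f_stage_increment_le y z s t : (forall a, leLb y a -> leLb z a) -> (s <= t)%N ->
  f_stage y t - f_stage y s <= f_stage z t - f_stage z s.
Proof.
move=> yz st; rewrite !f_stageE.
have E u :
  \sum_(0 <= a < t | leLb u a) stage_wt t a -
  \sum_(0 <= a < s | leLb u a) stage_wt s a =
  \sum_(0 <= a < t | leLb u a) (stage_wt t a - if (a < s)%N then stage_wt s a else 0).
  rewrite sumrB; congr (_ - _); rewrite (@big_cat_nat _ _ _ s 0 t) //=.
  rewrite [X in _ = _ + X]big_nat_cond [X in _ = _ + X]big1 ?addr0.
    rewrite big_nat_cond [RHS]big_nat_cond; apply: eq_bigr => a /andP[/andP[_ ->]] //.
  by move=> a /andP[/andP[sa _] _]; rewrite ltnNge sa.
rewrite !E big_mkcond [leRHS]big_mkcond; apply: ler_sum => a _ /=.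
have ge0 : 0 <= stage_wt t a - if (a < s)%N then stage_wt s a else 0.
  by case: ifP => _; rewrite subr_ge0 ?stage_wt_ge0 ?stage_wt_mono.
by case: ifP => [/yz ->|_] //; case: ifP.
Qed.

Lemma f_stage_le y z s : (forall a, leLb y a -> leLb z a) -> f_stage y s <= f_stage z s.
Proof.
move=> yz; rewrite !f_stageE big_mkcond [leRHS]big_mkcond; apply: ler_sum => a _ /=.
by case: ifP => [/yz ->|_] //; case: ifP => // _; apply: stage_wt_ge0.
Qed.

Lemma sum_pick m n a (v : nat -> R) : (m <= a < n)%N ->
  \sum_(m <= b < n) v b = v a + \sum_(m <= b < n | b != a) v b.
Proof. by move=> mn; rewrite (bigD1_seq a) ?mem_index_iota ?iota_uniq. Qed.

(** The sum for [z] contains that for [y] and the term of [a] in addition. *)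
Lemma f_stage_gap y z a u s :
  leLb z a -> ~~ leLb y a -> (forall b, leLb y b -> leLb z b) ->
  (u <= s)%N -> (a < s)%N -> f_stage y s + stage_wt u a <= f_stage z s.
Proof.
move=> za ya yz us asx; rewrite !f_stageE [leRHS]big_mkcond.
rewrite [X in X + _ <= _]big_mkcond !(@sum_pick _ _ a) //=.
rewrite za (negbTE ya) add0r addrC lerD ?stage_wt_mono // ler_sum // => b _.
by case: ifP => [/yz ->|_] //; case: ifP => // _; apply: stage_wt_ge0.
Qed.

(** Strings with code at least [s] are not counted at stage [s]. *)
Lemma f_stage_omits y a s :
  leLb y a -> (s <= a)%N -> ((f_stage y s + final_wt a)%:E <= f R U y)%E.
Proof.
move=> ya sa; have [s0 s0P] := stage_wt_final a.
pose t := maxn a.+1 s0.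
have at_ : (a < t)%N by rewrite leq_max leqnn.
apply: le_trans (f_stage_le_f y t); rewrite lee_fin !f_stageE.
have st : (s <= t)%N by rewrite (leq_trans sa) // ltnW.
rewrite (@big_cat_nat _ _ _ s 0 t) //=; apply: lerD.
  by apply: ler_sum => b _; apply: stage_wt_mono.
rewrite big_mkcond (@sum_pick _ _ a) ?sa // ya -(s0P t) ?leq_maxr // lerDl.
by apply: sumr_ge0 => b _; case: ifP => // _; apply: stage_wt_ge0.
Qed.

End Approx.

Lemma computable_stage_num z e s a : computable z s -> computable z a ->
  computable z (fun n => stage_num e (s n) (a n)).
Proof.
move=> cs ca; apply: (@computable_app2 _ (stage_num e)) => //; rewrite /stage_num.
apply: (@computable_max _ p1 (fun q p =>
  if run e p (p1 q) == (p2 q).+1 then 2 ^ (p1 q - code_size p) else 0)).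
  by computability.
apply: computable_if; last exact: computable_cst.
  by apply: computable_eq; [apply: computable_run|]; computability.
apply: computable_expn; apply: computable_sub; first by computability.
by apply: computable_code_size; computability.
Qed.

Lemma computable_f_num z e (Y : nat -> nat -> bool) s :
  computable z (fun q => Y (p1 q) (p2 q)) -> computable z s ->
  computable z (fun n => f_num e (Y n) (s n)).
Proof.
move=> cY cs; rewrite /f_num.
apply: (@computable_sum _ s (fun n a => if leLb (Y n) a then stage_num e (s n) a else 0)) => //.
apply: computable_if; last exact: computable_cst.
  apply: (@computable_leLb _ (fun q i => Y (p1 q) i)); last by computability.
  by apply: (@computable_app2 _ (fun n i => Y n i : nat)) => //; computability.
apply: computable_stage_num; last by computability.
by apply: (@computable_comp _ s) => //; computability.
Qed.

Lemma computable_choose z (P : nat -> nat -> bool) :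
  computable z (fun q => P (p1 q) (p2 q)) -> (forall n, exists i, P n i) ->
  exists m, computable z m /\ forall n, P n (m n).
Proof.
move=> cP exP; exists (fun n => ex_minn (exP n)); split.
  by apply: computable_search cP _ _ => n; case: ex_minnP.
by move=> n; case: ex_minnP.
Qed.

(** * Binary digits and dyadic fractions *)

Definition ones : cantor := fun=> true.

(** The first [m] bits of [y], read as a number in binary. *)
Definition digits (y : cantor) m := iteri m (fun i q => 2 * q + y i) 0.

Lemma computable_digits z (y : cantor) m : computable z y -> computable z m ->
  computable z (fun n => digits y (m n)).
Proof.
move=> cy cm; rewrite /digits.
apply: (@computable_iteri _ m (fun=> 0) (fun _ i q => 2 * q + y i)) => //.
  exact: computable_cst.
apply: computable_add; first by computability.
by apply: (computable_comp cy); computability.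
Qed.

Section Parts.
Import Order.TTheory GRing.Theory Num.Theory.
Local Open Scope ring_scope.

Lemma exp2N_small (R : realType) (eps : R) : 0 < eps -> exists k, 2 ^- k < eps.
Proof.
move=> eps0; have [k kP] : exists k : nat, eps^-1 < k%:R.
  by exists (Num.bound eps^-1); apply: archi_boundP; rewrite invr_ge0 ltW.
exists k; rewrite invf_plt ?posrE ?two_gt0 //; apply: lt_le_trans kP _.
by rewrite -natr_exp2 ler_nat ltnW // ltn_expl.
Qed.

Lemma le_divr2 (R : realType) (a b s t : nat) :
  (a%:R / 2 ^+ s <= b%:R / 2 ^+ t :> R) = (a * 2 ^ t <= b * 2 ^ s)%N.
Proof.
rewrite ler_pdivrMr ?two_gt0 // mulrAC ler_pdivlMr ?two_gt0 //.
by rewrite -!natr_exp2 -!natrM ler_nat.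
Qed.

Lemma div_exp2D (R : realType) (a b s t : nat) :
  (a%:R / 2 ^+ s + b%:R / 2 ^+ t = (a * 2 ^ t + b * 2 ^ s)%N%:R / 2 ^+ (s + t) :> R).
Proof.
rewrite exprD natrD !natrM !natr_exp2; field.
by rewrite !lt0r_neq0 ?two_gt0.
Qed.

Section Digits.
Variables (R : realType) (y : cantor) (r : R).
Hypothesis yr : binary_expansion y r%:E.

Definition low m : R := (digits y m)%:R / 2 ^+ m.

Lemma lowS m : low m.+1 = low m + (y m)%:R / 2 ^+ m.+1.
Proof.
rewrite /low /digits iteriS -/(digits y m) natrD natrM exprS.
by field; rewrite lt0r_neq0 ?two_gt0.
Qed.

Lemma lowE m : low m = \sum_(0 <= i < m) (y i)%:R / 2 ^+ i.+1.
Proof.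
elim: m => [|m IHm]; first by rewrite big_geq // /low mul0r.
by rewrite lowS IHm big_nat_recr.
Qed.

Lemma upE m : low m + 2 ^- m = (digits y m).+1%:R / 2 ^+ m.
Proof. by rewrite -[(_ y m).+1]addn1 natrD mulrDl mul1r. Qed.

Lemma low_mono m n : (m <= n)%N -> low m <= low n.
Proof.
move=> /subnK <-; elim: (n - m)%N => // k IHk; apply: le_trans IHk _.
by rewrite addSn lowS lerDl divr_ge0 // ltW // two_gt0.
Qed.

Lemma up_mono m n : (m <= n)%N -> low n + 2 ^- n <= low m + 2 ^- m.
Proof.
move=> /subnK <-; elim: (n - m)%N => // k; apply: le_trans.
rewrite addSn lowS -addrA lerD2l exprS invfM.
have : 0 < 2 ^- (k + m) :> R by rewrite invr_gt0 two_gt0.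
by case: (y _) => /=; lra.
Qed.

Lemma low_le m : low m <= r.
Proof.
rewrite -lee_fin yr lowE -sumEFin; apply: nneseries_lim_ge => i _ _.
by rewrite lee_fin divr_ge0 // ltW // two_gt0.
Qed.

Lemma le_up m : r <= low m + 2 ^- m.
Proof.
rewrite -lee_fin yr; apply: lime_le.
  apply: is_cvg_nneseries => i _ _.
  by rewrite lee_fin divr_ge0 // ltW // two_gt0.
apply: nearW => n; rewrite sumEFin lee_fin -lowE.
have [mn|/ltnW nm] := leqP m n.
  by apply: le_trans (up_mono mn); rewrite lerDl invr_ge0 ltW // two_gt0.
by apply: le_trans (low_mono nm) _; rewrite lerDl invr_ge0 ltW // two_gt0.
Qed.

(** Without a later 1 the real could be equal to its lower approximation; with a
    later 0 it stays below the upper one. *)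
Lemma low_lt m n : (m <= n)%N -> y n -> low m < r.
Proof.
move=> mn yn; apply: lt_le_trans (low_le n.+1); rewrite lowS yn mul1r.
have := low_mono mn; have : 0 < 2 ^- n.+1 :> R by rewrite invr_gt0 two_gt0.
lra.
Qed.

Lemma lt_up m n : (m <= n)%N -> ~~ y n -> r < low m + 2 ^- m.
Proof.
move=> mn /negbTE yn; apply: le_lt_trans (le_up n.+1) _; rewrite lowS yn mul0r addr0.
have := up_mono mn; have : 0 < 2 ^- n :> R by rewrite invr_gt0 two_gt0.
rewrite exprS invfM; lra.
Qed.

End Digits.

(** * The three reductions *)

Section Main.
Variables (R : realType) (U : machine) (e : nat).
Hypothesis optU : optimal U.
Hypothesis eU : forall p v,
  (exists s, run e p s = v.+1) <-> omap str_code (U (str_of p)) = Some v.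

Local Notation f := (f R U).
Local Notation f_stage := (f_stage R e).

Lemma f_stage_approx y r (eps : R) :
  f y = r%:E -> 0 < eps -> exists s, r - eps < f_stage y s.
Proof.
move=> fr eps0; apply: contrapT => /forallNP nex.
have := @f_le_bound R U e eU y 0 (r - eps); rewrite fr lee_fin.
have H t : (0 <= t)%N -> f_stage y t <= r - eps.
  by move=> _; rewrite leNgt; apply/negP/nex.
by move=> /(_ H); lra.
Qed.

Lemma f_fin y : exists r, f y = r%:E.
Proof.
exists (fine (f y)); rewrite fineK // ge0_fin_numE ?f_ge0 //.
apply: le_lt_trans (ltry 1); apply: f_le1; exact: optU.1.2.
Qed.

(** One modulus serves all sequences because the increments between stages are
    largest at [ones]. *)
Lemma exists_modulus z : computable z (jump emptyset) ->
  exists m, computable z m /\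
    forall k y r, f y = r%:E -> r <= f_stage y (m k) + 2 ^- k.
Proof.
move=> cj.
(* [q] is the pair of the precision [k] and a stage [s]; the numerators state
   that [f_t - f_s >= 2^-k] at [ones]. *)
pose P q t := (2 ^ t * 2 ^ p2 q + f_num e ones (p2 q) * 2 ^ t * 2 ^ p1 q <=
  f_num e ones t * 2 ^ p2 q * 2 ^ p1 q)%N.
have PE k s t : P (cpair k s) t = (f_stage ones s + 2 ^- k <= f_stage ones t).
  rewrite /P /f_stage p1K p2K -[2 ^- k]mul1r (div_exp2D R _ 1) le_divr2 expnD.
  by congr (_ <= _)%N; ring.
have cP : computable emptyset (fun q => P (p1 q) (p2 q)).
  have cw g : computable emptyset g ->
      computable emptyset (fun n => f_num e ones (g n)).
    move=> cg; apply: (@computable_f_num _ e (fun _ => ones)) => //.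
    exact: computable_cst.
  by rewrite /P; computability; apply: cw; computability.
have [r1 fr1] := f_fin ones.
have [m [cm mP]] : exists m, computable z m /\
    forall k, ~~ `[< exists t, P (cpair k (m k)) t >].
  apply: (@computable_choose z (fun k s => ~~ `[< exists t, P (cpair k s) t >])).
    apply: computable_negb; apply: (computable_ext _ (computable_exists_jump cP cj)).
    by move=> q; rewrite pK.
  move=> k; have k0 : 0 < 2 ^- k :> R by rewrite invr_gt0 two_gt0.
  have [s sP] := f_stage_approx fr1 k0.
  exists s; apply/asboolPn => -[t]; rewrite PE => tP.
  have := f_stage_le_f R eU ones t; rewrite fr1 lee_fin; lra.
exists m; split=> // k y r fr.
rewrite -lee_fin -fr; apply: (@f_le_bound R U e eU y (m k)) => t mt.
rewrite leNgt; apply/negP => gap; have /asboolPn [] := mP k; exists t; rewrite PE.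
have := @f_stage_increment_le R e y ones (m k) t _ mt.
have yones a : leLb y a -> leLb ones a by move=> _; apply/leLbP/leLP.
move=> /(_ yones); lra.
Qed.

(** An approximation of the real determines its first [n + 1] bits as soon as the
    interval that it gives lies in one dyadic interval of length [2^-(n + 1)].
    This happens eventually if the real is not an end point of such an interval,
    that is, if its digits are not eventually constant. *)
Lemma computable_value z (x fx : cantor) :
  computable z (jump emptyset) -> computable z x ->
  binary_expansion fx (f x) -> computable z fx.
Proof.
move=> cj cx fxE.
have [[n0 [b n0P]]|ncst] := pselect (exists n0 b, forall n, (n0 <= n)%N -> fx n = b).
  by apply: (@computable_eventually z _ b n0) => n /n0P ->.
have ex_digit b n : exists2 k, (n <= k)%N & fx k = b.
  apply: contrapT => nex; apply: ncst; exists n, (~~ b) => k nk.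
  by case: (fx k =P b) => [kb|]; [case: nex; exists k | case: (fx k) b {nex} => [] []].
have [m [cm mP]] := exists_modulus cj.
have [r fr] := f_fin x; rewrite fr in fxE.
(* [j n k] is the number of the dyadic interval that contains the lower bound
   for precision [2^-k]; [P n k] says that the upper bound lies in it as well. *)
pose j n k := (f_num e x (m k) * 2 ^ n.+1 %/ 2 ^ m k)%N.
pose P n k := (f_num e x (m k) * 2 ^ k * 2 ^ n.+1 + 2 ^ m k * 2 ^ n.+1 <=
  (j n k).+1 * 2 ^ m k * 2 ^ k)%N.
have PE n k : P n k = (f_stage x (m k) + 2 ^- k <= (j n k).+1%:R / 2 ^+ n.+1).
  rewrite /P /f_stage -[2 ^- k]mul1r (div_exp2D R _ 1) le_divr2 expnD.
  by congr (_ <= _)%N; ring.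
have j_le n k : (j n k)%:R / 2 ^+ n.+1 <= f_stage x (m k).
  by rewrite le_divr2 leq_divM.
have lt_j n k : f_stage x (m k) < (j n k).+1%:R / 2 ^+ n.+1.
  by rewrite ltNge le_divr2 -ltnNge ltn_ceil // expn_gt0.
have lowr n : low R fx n < r.
  by have [k nk fk] := ex_digit true n; apply: low_lt nk _.
have rup n : r < low R fx n + 2 ^- n.
  by have [k nk fk] := ex_digit false n; apply: lt_up nk _; rewrite ?fk.
have cw g : computable z g -> computable z (fun n => f_num e x (g n)).
  by move=> cg; apply: (@computable_f_num _ e (fun _ => x)) => //;
    apply: (computable_comp cx); computability.
have cmg g : computable z g -> computable z (fun n => m (g n)).
  exact: computable_comp cm.
have [k [ck kP]] : exists k, computable z k /\ forall n, P n (k n).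
  apply: computable_choose.
    rewrite /P /j.
    by computability; do ?apply: cw; apply: cmg; computability.
  move=> n; have := lowr n.+1; have := rup n.+1 => {}rup {}lowr.
  have [k kP] : exists k, 2 ^- k < Num.min (r - low R fx n.+1)
      (low R fx n.+1 + 2 ^- n.+1 - r).
    by apply: exp2N_small; rewrite lt_min; lra.
  move: kP; rewrite lt_min => /andP[kl ku].
  exists k; rewrite PE; have rk := mP k x r fr.
  have : f_stage x (m k) <= r by rewrite -lee_fin -fr f_stage_le_f.
  have : low R fx n.+1 + 2 ^- n.+1 <= (j n k).+1%:R / 2 ^+ n.+1.
    rewrite upE ler_pM2r ?invr_gt0 ?two_gt0 // ler_nat ltnS.
    have : low R fx n.+1 < (j n k).+1%:R / 2 ^+ n.+1.
      by apply: le_lt_trans (lt_j n k); lra.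
    by rewrite /low ltr_pM2r ?invr_gt0 ?two_gt0 // ltr_nat ltnS.
  lra.
apply: (@computable_ext _ (fun n => odd (j n (k n)))).
  move=> n; congr nat_of_bool.
  have -> : j n (k n) = digits fx n.+1.
    have : low R fx n.+1 < (j n (k n)).+1%:R / 2 ^+ n.+1.
      have := kP n; rewrite PE; have := mP (k n) x r fr; have := lowr n.+1; lra.
    have : (j n (k n))%:R / 2 ^+ n.+1 < (digits fx n.+1).+1%:R / 2 ^+ n.+1 :> R.
      rewrite -upE; apply: le_lt_trans (j_le n (k n)) _.
      by apply: le_lt_trans (rup n.+1); rewrite -lee_fin -fr f_stage_le_f.
    rewrite /low !ltr_pM2r ?invr_gt0 ?two_gt0 // !ltr_nat; lia.
  by rewrite /digits iteriS oddD mul2n odd_double /=; case: (fx n).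
rewrite /j; computability; do ?apply: cw; apply: cmg => //; computability.
Qed.

(** Every string has a program, by [K_le_index] for the identity. *)
Lemma stage_num_pos a : exists u, (a < u)%N && (0 < stage_num e u a)%N.
Proof.
have [c cP] := computable_id emptyset.
have [d /(_ a a (cP a)) dP] := K_le_index c optU.
have [u0 u0P] := stage_wt_final R eU a; exists (maxn a.+1 u0).
rewrite leq_maxl lt0n; apply/eqP => w0.
have := u0P _ (leq_maxr a.+1 u0); rewrite /stage_wt w0 mul0r /final_wt.
case: (K U _) dP => [k|//] _ /= k0.
by have := two_gt0 R k; rewrite -invr_gt0 -k0 ltxx.
Qed.

(** The strings [a <=L x] are those with [f(a 0^omega) <= f(x)], and for the other
    ones there is a gap that is bounded below by the contribution of [a]. *)
Lemma computable_input z (x fx : cantor) :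
  computable z (jump emptyset) -> computable z fx ->
  binary_expansion fx (f x) -> computable z x.
Proof.
move=> cj cfx fxE.
have [m [cm mP]] := exists_modulus cj.
have [r fr] := f_fin x; rewrite fr in fxE.
have [u [cu uP]] : exists u, computable z u /\
    forall a, (a < u a)%N && (0 < stage_num e (u a) a)%N.
  apply: computable_choose stage_num_pos.
  by computability; apply: computable_stage_num; computability.
(* [pad a] is [a 0^omega]. *)
pose pad a i := (i < code_size a)%N && code_bit a i.
have padE a : pad a = nth false (str_of a).
  apply: funext => i; rewrite /pad; case: ltnP => [ia|ai] /=.
    by rewrite nth_mkseq.
  by rewrite nth_default // size_mkseq.
(* At stage [u a] the contribution of [a] is positive, hence at least [2^-u a],
   as it has denominator [2^u a].  A quarter of this is the precision needed
   for both reals. *)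
pose D a := (f_num e (pad a) (m (u a).+2) * 2 ^ (u a).+2 <=
  (digits fx (u a).+2).+1 * 2 ^ m (u a).+2)%N.
have DE a : D a = leLb x a.
  rewrite /D -(le_divr2 R) -upE -/(f_stage _ _).
  set k := (u a).+2; set s := m k.
  apply/idP/idP => [le_up|/leLbP /leLP ax]; last first.
    apply: le_trans (le_up fxE k); rewrite -lee_fin -fr.
    apply: le_trans (f_stage_le_f R eU x s); rewrite lee_fin.
    apply: f_stage_le => b /leLbP /leLP ba; apply/leLbP/leLP; apply: lexle_trans ba _.
    by rewrite padE.
  apply/negPn/negP => nax.
  have /andP[au wu] := uP a.
  have sub b : leLb x b -> leLb (pad a) b.
    move=> /leLbP /leLP bx; apply/leLbP/leLP; apply: lexle_trans bx _.
    by rewrite padE; apply: lexle_total => /leLP /leLbP; apply/negP.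
  have aa : leLb (pad a) a by apply/leLbP/leLP; rewrite padE.
  have [ra fa] := f_fin (pad a).
  have jump_r : r <= ra - stage_wt R e (u a) a.
    rewrite -lee_fin -fr; apply: (@f_le_bound R U e eU x (u a)) => t ut.
    have := @f_stage_gap R e x (pad a) a (u a) t aa nax sub ut (leq_trans au ut).
    have : f_stage (pad a) t <= ra by rewrite -lee_fin -fa f_stage_le_f.
    lra.
  have wt_u : 2 ^- u a <= stage_wt R e (u a) a.
    by rewrite -[2 ^- _]mul1r ler_pM2r ?invr_gt0 ?two_gt0 // ler1n.
  have := mP k _ _ fa; have := low_le fxE k; rewrite -/s.
  have : 2 ^- u a = 4 * 2 ^- k :> R.
    by rewrite /k !exprS; field; rewrite lt0r_neq0 ?two_gt0.
  have : 0 < 2 ^- k :> R by rewrite invr_gt0 two_gt0.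
  lra.
have cD : computable z D.
  have cdig g : computable z g -> computable z (fun n => digits fx (g n)).
    exact: computable_digits.
  have cmg g : computable z g -> computable z (fun n => m (g n)).
    exact: computable_comp cm.
  rewrite /D; computability.
  - apply: computable_f_num; last by apply: cmg; computability.
    rewrite /pad; computability; last by apply: computable_code_bit; computability.
    by apply: computable_code_size; computability.
  - by apply: cdig; computability.
  - by apply: cmg; computability.
(* The next bit of [x] is 1 if and only if the known bits followed by 1 form a
   string [<=L x].  Appending a bit [b] to a string of length [n] adds
   [2^n * (b + 1)] to its code. *)
pose A n := str_code (mkseq x n).
have xD n : x n = D (A n + 2 ^ n * 2)%N.
  have -> : (A n + 2 ^ n * 2)%N = str_code (rcons (mkseq x n) true).
    by rewrite str_code_rcons size_mkseq.
  have nthx i : (i < n)%N -> nth false (rcons (mkseq x n) true) i = x i.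
    by move=> in_; rewrite nth_rcons size_mkseq in_ nth_mkseq.
  have nthn : nth false (rcons (mkseq x n) true) n = true.
    by rewrite nth_rcons size_mkseq ltnn eqxx.
  rewrite DE; apply/idP/leLbP; rewrite str_codeK; [move=> xn | move=> /leLP h].
    apply/leLP => i agree; have [in_|ni|->//] := ltngtP i n.
      by rewrite nthx.
    by rewrite nth_default // size_rcons size_mkseq.
  by apply: h => //; rewrite nthn.
pose B n := iteri n (fun i q => q + 2 ^ i * (D (q + 2 ^ i * 2)).+1)%N 0%N.
have AB n : A n = B n.
  elim: n => // n IHn.
  by rewrite /A mkseqS str_code_rcons size_mkseq [B _]/= -/(B n) -IHn -xD.
apply: (@computable_ext _ (fun n => D (B n + 2 ^ n * 2)%N)).
  by move=> n; rewrite -AB -xD.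
have cDg g : computable z g -> computable z (fun n => D (g n)).
  exact: computable_comp cD.
apply: (cDg _); rewrite /B; computability.
by apply: cDg; computability.
Qed.

(** A program that halts at stage [t] makes the string [0^t] simple, and [0^t]
    contributes to [f(x)] for every [x]; so [f(x)] cannot be approximated well
    before stage [t]. *)
Lemma computable_halting z (x fx : cantor) :
  computable z x -> computable z fx ->
  binary_expansion fx (f x) -> computable z (jump emptyset).
Proof.
move=> cx cfx fxE.
have [r fr] := f_fin x; rewrite fr in fxE.
(* [(2 ^ t0).-1] is the code of the string of [t0] zeros. *)
have [c cP] : exists c, forall n t, halts n t ->
    exists2 t0, halts n t0 & eval emptyset c n (2 ^ t0).-1.
  have [w wP] : computable emptyset (fun q => ~~ halts (p1 q) (p2 q)).
    rewrite /halts; computability.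
    by apply: computable_run; computability.
  have [d dP] : computable emptyset (fun t => (2 ^ t).-1) by computability.
  exists (Comp d (Mu w)) => n t nt; have ex : exists t, halts n t by exists t.
  exists (ex_minn ex); case: ex_minnP => // t0 nt0 t0_min.
  apply: eval_Comp (dP _); apply: (@eval_Mu _ _ _ _ (fun=> 0%N)).
    move=> i it; have := wP (cpair n i); rewrite p1K p2K.
    by case hi: (halts n i) => //; move/t0_min: hi; rewrite leqNgt it.
  by have := wP (cpair n t0); rewrite p1K p2K nt0.
have [d dP] := K_le_index c optU.
(* The digits give [f(x)] up to [2^-(d + n + 1)], which is half of the bound
   needed on the distance of [f_s(x)] from [f(x)]. *)
pose P n s := (digits fx (d + n).+1 * 2 ^ s <
  f_num e x s * 2 ^ (d + n).+1 + 2 ^ s)%N.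
have PE n s : P n s = (low R fx (d + n).+1 < f_stage x s + 2 ^- (d + n).+1).
  rewrite ltNge -[2 ^- _]mul1r (div_exp2D R _ 1) le_divr2 mul1n expnD mulnA.
  by rewrite leq_pmul2r ?expn_gt0 // -ltnNge.
have [s [cs sP]] : exists s, computable z s /\ forall n, P n (s n).
  apply: computable_choose.
    rewrite /P; computability.
      by apply: computable_digits => //; computability.
    apply: (@computable_f_num _ e (fun _ => x)); last by computability.
    by apply: (computable_comp cx); computability.
  move=> n; set k := (d + n).+1.
  have k0 : 0 < 2 ^- k :> R by rewrite invr_gt0 two_gt0.
  have [t tP] := f_stage_approx fr k0.
  by exists t; rewrite PE; have := low_le fxE k; rewrite -/k; lra.
apply: (@computable_ext _ (fun n => halts n (s n))); last first.
  by rewrite /halts; computability; apply: computable_run; computability.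
move=> n; rewrite jump_halts; congr nat_of_bool.
apply/idP/asboolP => [?|[t nt]]; first by exists (s n).
have [t0 nt0 /dP Kt0] := cP n t nt.
apply: halts_mono nt0; rewrite leqNgt; apply/negP => st0.
have xt0 : leLb x (2 ^ t0).-1.
  apply/leLbP/leLP => i _; have -> : (2 ^ t0).-1 = str_code (nseq t0 false).
    by rewrite -str_code_nseq.
  by rewrite str_codeK nth_nseq if_same.
have st : (s n <= (2 ^ t0).-1)%N.
  by rewrite (leq_trans (ltnW st0)) // -ltnS prednK ?expn_gt0 // ltn_expl.
have := f_stage_omits R eU xt0 st; rewrite fr lee_fin.
have : 2 ^- (d + n) <= final_wt R U (2 ^ t0).-1.
  by rewrite /final_wt; case: (K U _) Kt0 => [k|//] /=; apply: exp2N_le.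
have := le_up fxE (d + n).+1.
have := sP n; rewrite PE exprS invfM; lra.
Qed.

End Main.
End Parts.

Theorem theorem4p3 (R : realType) (U : machine) (hU : optimal U) (x : cantor)
    (fx : cantor) (hfx : binary_expansion fx (f R U x)) :
  [/\ jump x >=T join (jump emptyset) x /\ join (jump emptyset) x >=T fx,
      jump fx >=T join (jump emptyset) fx /\ join (jump emptyset) fx >=T x &
      join fx x >=T jump emptyset].
Proof.
have [c cP] := hU.1.1.
have eU p v : (exists s, run (encode c) p s = v.+1) <->
    omap str_code (U (str_of p)) = Some v.
  rewrite -cP str_ofK; split=> [[s /run_eval[d /encode_inj ->]]//|].
  exact: eval_run.
have [cl cr] := (computable_joinl, computable_joinr).
split; [split|split|].
- exact: jump_ge_join.
- exact: (computable_value hU eU (cl _ _) (cr _ _) hfx).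
- exact: jump_ge_join.
- exact: (computable_input hU eU (cl _ _) (cr _ _) hfx).
- exact: (computable_halting hU eU (cr _ _) (cl _ _) hfx).
Qed.
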